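(* Let $\mathcal{C}=\{[X_0,X_1,X_2,X_3]\in\mathbb{CP}^3:\ X_0X_3^2+X_1^2X_2=0\}$. The twistor discriminant locus of the cubic scroll $\mathcal{C}$ consists of a $2$-sphere with $6$ handles, each pinched at one pole ($0$ or $\infty$) and at a third root of $-1$ lying on an equator: $$Disc(\mathcal{C})=\Sigma=\hat{\mathbb{C}}_i\ \cup\bigcup_{\substack{P\in\{0,\infty\}\\ z_m\in\mathbb{C}_i,\ z_m^3=-1}}\Sigma_{P,z_m},$$ where $\Sigma_{P,z_m}$ denotes a handle pinched to $\hat{\mathbb{C}}_i$ at $P$ and $z_m$.
   Context: Let $\mathbb{H}$ be the quaternions with basis $1,i,j,k$, and $\mathbb{C}_i=\mathbb{R}+\mathbb{R}i$, identified with $\mathbb{C}$. The left quaternionic projective line $\mathbb{HP}^1$ is the set of classes $[q_1,q_2]\sim[pq_1,pq_2]$, $p\in\mathbb{H}\setminus\{0\}$. One identifies $\mathbb{S}^4\simeq\mathbb{HP}^1=\mathbb{H}\cup\{\infty\}$ via $q\mapsto[1,q]$, $\infty=[0,1]$, and writes $\hat{\mathbb{C}}_i=\mathbb{C}_i\cup\{\infty\}\subset\mathbb{S}^4$. The twistor fibration is $\pi:\mathbb{CP}^3\to\mathbb{HP}^1$, $\pi[X_0,X_1,X_2,X_3]=[X_0+X_1j,\,X_2+X_3j]$. For an algebraic surface $\mathcal{S}\subset\mathbb{CP}^3$ of degree $d$, the twistor discriminant locus is $Disc(\mathcal{S})=\{p\in\mathbb{S}^4:\ \#(\pi^{-1}(p)\cap\mathcal{S})\neq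 d\}$. A handle $\Sigma_{P,z}$ pinched to $\hat{\mathbb{C}}_i$ at $P$ and $z$ is a surface in $\mathbb{S}^4$ containing $P$ and $z$, meeting $\hat{\mathbb{C}}_i$ exactly in $\{P,z\}$, and such that $\Sigma_{P,z}\setminus\{P,z\}$ is homeomorphic to a cylinder $\mathbb{S}^1\times(0,1)$ whose two ends are collapsed to $P$ and $z$ respectively; distinct handles meet at most at their common attaching points. *)

(* Defs.v *)
From HB Require Import structures.
From mathcomp Require Import all_boot all_order all_algebra generic_quotient.
From mathcomp Require Import complex ring lra.
From mathcomp Require Import all_classical all_reals all_analysis.

Set Implicit Arguments.
Unset Strict Implicit.
Unset Printing Implicit Defensive.

Import Order.TTheory GRing.Theory Num.Theory.
Import numFieldNormedType.Exports.

Local Open Scope classical_set_scope.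
Local Open Scope ring_scope.
Local Open Scope quotient_scope.

(* [(a, b, c, d)] stands for a + b i + c j + d k.  The additive group and the
   topology are those of R^4; the multiplication is Hamilton's, not the
   componentwise one of the product ring. *)
Definition quat (R : realType) : Type := (R * R * R * R)%type.

Section Quaternions.
Variable R : realType.

HB.instance Definition _ := Topological.copy (quat R) (R * R * R * R)%type.
HB.instance Definition _ := GRing.Zmodule.copy (quat R) (R * R * R * R)%type.

Definition qmul (p q : quat R) : quat R :=
  let: (a, b, c, d) := p in let: (a', b', c', d') := q in
  (a * a' - b * b' - c * c' - d * d',
   a * b' + b * a' + c * d' - d * c',
   a * c' - b * d' + c * a' + d * b',
   a * d' + b * c' - c * b' + d * a').

Definition qone : quat R := (1, 0, 0, 0).

Definition qinv (q : quat R) : quat R :=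
  let: (a, b, c, d) := q in
  let n := a ^+ 2 + b ^+ 2 + c ^+ 2 + d ^+ 2 in
  (a / n, - b / n, - c / n, - d / n).

Let quat_eq (a b c d a' b' c' d' : R) :
  a = a' -> b = b' -> c = c' -> d = d' ->
  (a, b, c, d) = (a', b', c', d') :> quat R.
Proof. by move=> -> -> -> ->. Qed.

Fact qmulA : associative qmul.
Proof.
by move=> [[[? ?] ?] ?] [[[? ?] ?] ?] [[[? ?] ?] ?]; apply: quat_eq; ring.
Qed.

Fact qmul1q : left_id qone qmul.
Proof. by move=> [[[? ?] ?] ?]; apply: quat_eq; ring. Qed.

Fact qmulq1 : right_id qone qmul.
Proof. by move=> [[[? ?] ?] ?]; apply: quat_eq; ring. Qed.

Fact qmulDl : left_distributive qmul +%R.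
Proof.
by move=> [[[? ?] ?] ?] [[[? ?] ?] ?] [[[? ?] ?] ?]; apply: quat_eq => /=; ring.
Qed.

Fact qmulDr : right_distributive qmul +%R.
Proof.
by move=> [[[? ?] ?] ?] [[[? ?] ?] ?] [[[? ?] ?] ?]; apply: quat_eq => /=; ring.
Qed.

Fact qone_neq0 : qone != 0.
Proof. by apply/eqP => -[] /eqP; rewrite oner_eq0. Qed.

HB.instance Definition _ := GRing.Zmodule_isNzRing.Build (quat R)
  qmulA qmul1q qmulq1 qmulDl qmulDr qone_neq0.

Let qnorm_neq0 (a b c d : R) : (a, b, c, d) != 0 :> quat R ->
  a ^+ 2 + b ^+ 2 + c ^+ 2 + d ^+ 2 != 0.
Proof.
apply: contra_neq => n0.
have := (sqr_ge0 a, sqr_ge0 b, sqr_ge0 c, sqr_ge0 d) => -[[[a0 b0] c0] d0].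
have sq0 (x : R) : x ^+ 2 = 0 -> x = 0 by move/eqP; rewrite sqrf_eq0 => /eqP.
by apply: quat_eq; apply: sq0; lra.
Qed.

Fact qmulVq : {in [pred q : quat R | q != 0], left_inverse 1 qinv *%R}.
Proof.
move=> [[[a b] c] d] /qnorm_neq0 n0.
by apply: quat_eq; field.
Qed.

Fact qmulqV : {in [pred q : quat R | q != 0], right_inverse 1 qinv *%R}.
Proof.
move=> [[[a b] c] d] /qnorm_neq0 n0.
by apply: quat_eq; field.
Qed.

Fact quat_unitP (p q : quat R) : q * p = 1 /\ p * q = 1 -> p != 0.
Proof.
by case=> qp _; apply/eqP => p0; move/eqP: qp; rewrite p0 mulr0 eq_sym oner_eq0.
Qed.

Fact qinv0id : {in [predC [pred q : quat R | q != 0]], qinv =1 id}.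
Proof.
move=> q; rewrite !inE negbK => /eqP ->.
by apply: quat_eq; rewrite ?oppr0 mul0r.
Qed.

HB.instance Definition _ := GRing.NzRing_hasMulInverse.Build (quat R)
  qmulVq qmulqV quat_unitP qinv0id.

Lemma quat_unitE (q : quat R) : (q \is a GRing.unit) = (q != 0).
Proof. by []. Qed.

Definition qj : quat R := (0, 0, 1, 0).

Definition quat_of_C (z : R[i]) : quat R := (complex.Re z, complex.Im z, 0, 0).

End Quaternions.

Section ProjectiveLine.
Variable R : realType.

Definition nzpair : set (quat R * quat R) := [set q | q <> (0, 0)].

Definition hp_rel (u v : nzpair) : bool :=
  `[< exists2 p : quat R, p != 0 &
        \val v = (p * (\val u).1, p * (\val u).2) >].

Fact hp_rel_equiv : equiv_class_of hp_rel.
Proof.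
split.
- move=> u; apply/asboolP; exists 1; first exact: oner_neq0.
  by rewrite !mul1r -surjective_pairing.
- have sym u v : hp_rel u v -> hp_rel v u.
    move=> /asboolP[p p0 vE]; apply/asboolP.
    exists p^-1; first by rewrite -quat_unitE unitrV.
    by rewrite vE /= !mulKr ?quat_unitE// -surjective_pairing.
  by move=> u v; apply/idP/idP; exact: sym.
- move=> v u w /asboolP[p p0 vE] /asboolP[p' p'0 wE]; apply/asboolP.
  exists (p' * p); first by rewrite -quat_unitE unitrMl quat_unitE.
  by rewrite wE vE /= !mulrA.
Qed.

Canonical hp_equiv := EquivRelPack hp_rel_equiv.

Definition HP1 := quotient_topology {eq_quot hp_equiv}.

HB.instance Definition _ := Topological.on HP1.
HB.instance Definition _ := Quotient.on HP1.

Definition hp_class (q : quat R * quat R) (q0 : q <> (0, 0)) : HP1 :=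
  \pi_HP1 (SigSub (mem_set q0 : q \in nzpair)).

Fact affine_neq0 (q : quat R) : (1, q) <> (0, 0) :> quat R * quat R.
Proof. by case=> /eqP; rewrite oner_eq0. Qed.

Fact infinity_neq0 : (0, 1) <> (0, 0) :> quat R * quat R.
Proof. by case=> /eqP; rewrite oner_eq0. Qed.

Definition hp_affine (q : quat R) : HP1 := hp_class (@affine_neq0 q).
Definition hp_infty : HP1 := hp_class infinity_neq0.

Definition hp_of_C (z : R[i]) : HP1 := hp_affine (quat_of_C z).

Definition Chat : set HP1 := range hp_of_C `|` [set hp_infty].

End ProjectiveLine.

Arguments nzpair : clear implicits.
Arguments Chat : clear implicits.

Section Twistor.
Variable R : realType.

Definition nzvec : set 'rV[R[i]]_4 := [set X | X <> 0].

Definition cp_rel (X Y : nzvec) : bool :=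
  `[< exists2 a : R[i], a != 0 & \val Y = a *: \val X >].

Fact cp_rel_equiv : equiv_class_of cp_rel.
Proof.
split.
- by move=> X; apply/asboolP; exists 1; [exact: oner_neq0 | rewrite scale1r].
- have sym X Y : cp_rel X Y -> cp_rel Y X.
    move=> /asboolP[a a0 YE]; apply/asboolP; exists a^-1; first by rewrite invr_eq0.
    by rewrite YE scalerA mulVf // scale1r.
  by move=> X Y; apply/idP/idP; exact: sym.
- move=> Y X Z /asboolP[a a0 YE] /asboolP[b b0 ZE]; apply/asboolP.
  by exists (b * a); [rewrite mulf_neq0 | rewrite ZE YE scalerA].
Qed.

Canonical cp_equiv := EquivRelPack cp_rel_equiv.

Definition CP3 := {eq_quot cp_equiv}.

HB.instance Definition _ := Quotient.on CP3.
HB.instance Definition _ := Choice.on CP3.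

Definition twistor_vec (X : 'rV[R[i]]_4) : quat R * quat R :=
  (quat_of_C (X 0 0) + quat_of_C (X 0 1) * qj R,
   quat_of_C (X 0 2) + quat_of_C (X 0 3) * qj R).

Let twistor_vecE (X : 'rV[R[i]]_4) : twistor_vec X =
  ((complex.Re (X 0 0), complex.Im (X 0 0),
    complex.Re (X 0 1), complex.Im (X 0 1)),
   (complex.Re (X 0 2), complex.Im (X 0 2),
    complex.Re (X 0 3), complex.Im (X 0 3))).
Proof.
suff E (z w : R[i]) : quat_of_C z + quat_of_C w * qj R =
    (complex.Re z, complex.Im z, complex.Re w, complex.Im w).
  by rewrite /twistor_vec !E.
rewrite /quat_of_C; case: z w => [a b] [c d] /=.
by congr (_, _, _, _); rewrite /=; ring.
Qed.

Let twistor_vecZ (a : R[i]) (X : 'rV[R[i]]_4) :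
  twistor_vec (a *: X) =
  (quat_of_C a * (twistor_vec X).1, quat_of_C a * (twistor_vec X).2).
Proof.
rewrite !twistor_vecE !mxE /quat_of_C; case: a => a b /=.
case: (X 0 0) (X 0 1) (X 0 2) (X 0 3) => [? ?] [? ?] [? ?] [? ?].
by congr (_, _, _, _, (_, _, _, _)); rewrite /=; ring.
Qed.

Fact twistor_vec_neq0 (X : nzvec) : twistor_vec (\val X) <> (0, 0).
Proof.
case: X => X /=; rewrite inE /nzvec /= => X0.
have C0 (z : R[i]) : complex.Re z = 0 -> complex.Im z = 0 -> z = 0.
  by case: z => a b /= -> ->.
rewrite twistor_vecE => -[a0 b0 a1 b1 a2 b2 a3 b3]; apply: X0.
apply/rowP => k; rewrite mxE.
by case: k => -[|[|[|[|//]]]] lt_k;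
  [move: (C0 _ a0 b0) | move: (C0 _ a1 b1) |
   move: (C0 _ a2 b2) | move: (C0 _ a3 b3)] => <-;
  congr (X _ _); apply: val_inj.
Qed.

Definition twistor (x : CP3) : HP1 R :=
  hp_class (@twistor_vec_neq0 (repr x)).

(* [twistor] does not depend on the representative picked by [repr]. *)
Lemma twistor_pi (X : nzvec) :
  twistor (\pi_CP3 X) = hp_class (@twistor_vec_neq0 X).
Proof.
have /eqmodP/asboolP[a a0 XE] : repr (\pi_CP3 X) = X %[mod CP3].
  by rewrite reprK.
apply/eqmodP/asboolP; exists (quat_of_C a); last by rewrite /= XE twistor_vecZ.
apply: contra_neq a0 => -[].
by case: a {XE} => a b /= -> ->.
Qed.

(* [d] is the degree of the surface [S].  Fibres contained in [S] are infinite,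
   hence counted in. *)
Definition Disc (d : nat) (S : set CP3) : set (HP1 R) :=
  [set p | ~ (twistor @^-1` [set p] `&` S #= `I_d)%card].

Definition cubic_scroll : set CP3 :=
  [set \pi_CP3 X | X in [set X : nzvec |
     (\val X) 0 0 * (\val X) 0 3 ^+ 2 + (\val X) 0 1 ^+ 2 * (\val X) 0 2 = 0]].

End Twistor.

Arguments nzvec : clear implicits.
Arguments cubic_scroll : clear implicits.

Definition homeomorphism (A B : topologicalType) (f : A -> B) : Prop :=
  continuous f /\
  exists g : B -> A, [/\ continuous g, cancel f g & cancel g f].

Definition homeomorphic (A B : topologicalType) : Prop :=
  exists f : A -> B, homeomorphism f.

Section Handles.
Variable R : realType.

Definition circle : set (R * R) := [set x | x.1 ^+ 2 + x.2 ^+ 2 = 1].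

Definition sphere2 : set (R * R * R) :=
  [set x | x.1.1 ^+ 2 + x.1.2 ^+ 2 + x.2 ^+ 2 = 1].

Definition cylinder : set (R * R * R) := circle `*` `]0, 1[.

(* The end of the cylinder at height 0 collapses to [P] and the end at height 1
   to [Q]: the height tending to 0 (resp. 1) forces convergence to [P]
   (resp. [Q]), uniformly along the circle. *)
Definition pinched_handle (P Q : HP1 R) (S : set (HP1 R)) : Prop :=
  [/\ S P, S Q, S `&` Chat R = [set P; Q] &
    exists h : cylinder -> S `\` [set P; Q],
      [/\ homeomorphism h,
          forall U, nbhs P U -> \forall t \near 0^'+,
            forall c : cylinder, (\val c).2 = t -> U (\val (h c)) &
          forall U, nbhs Q U -> \forall t \near 1^'-,
            forall c : cylinder, (\val c).2 = t -> U (\val (h c))]].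

Definition poles : set (HP1 R) := [set hp_of_C 0; hp_infty R].

Definition cube_roots_m1 : set R[i] := [set z | z ^+ 3 = -1].

Definition equator : set R[i] := [set z | `|z| = 1].

End Handles.

Arguments circle : clear implicits.
Arguments sphere2 : clear implicits.
Arguments cylinder : clear implicits.
Arguments poles : clear implicits.
Arguments cube_roots_m1 : clear implicits.
Arguments equator : clear implicits.

(* Main.v *)
Require Import Defs.
From mathcomp Require Import all_boot all_order all_algebra generic_quotient.
From mathcomp Require Import complex ring lra.
From mathcomp Require Import all_classical all_reals all_analysis.

Set Implicit Arguments.
Unset Strict Implicit.
Unset Printing Implicit Defensive.

Import Order.TTheory GRing.Theory Num.Theory.
Import numFieldNormedType.Exports.

Local Open Scope classical_set_scope.
Local Open Scope ring_scope.
Local Open Scope quotient_scope.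

(** Write q = z + w j with z, w complex.  The twistor fibre over [1, q] is the
projective line of the points [x, y, x z - y w^*, x w + y z^*], and the cubic
restricts to it as the binary form
<<
  w^2 x^3 + 2 w z^* x^2 y + (z^*^2 + z) x y^2 - w^* y^3.
>>
When w = 0, that is on the Riemann sphere, the form is divisible by x y^2: it
has at most two roots or vanishes identically, and over infinity the whole
fibre lies on the scroll.  So the sphere belongs to the locus
([Disc_hp_of_C], [Disc_infty]).

When w <> 0 the form is a genuine cubic, and it has three distinct roots unless
its discriminant vanishes.  With n = |z|^2 and s = |w|^2 that discriminant is
- w^2 times
<<
  4 (n + s) z^*^3 + 4 z^3 + 8 n^2 + 36 s n + 27 s^2      ([discriminant3_fibre])
>>
whose imaginary part is 4 (1 - n - s) Im (z^3).  The factor 1 - n - s is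
spurious: put r = |z|; if it vanishes, the real part together with
Re (z^3) >= - r^3 gives (r + 3)^3 (r - 1) >= 0, hence r >= 1 and s <= 0.  So z^3
is real, in fact equal to - r^3, which means z = r om with om^3 = -1, and the
real part becomes the quadratic equation
<<
  27 s^2 + 4 r^2 (9 - r) s - 4 r^3 (r - 1)^2 = 0
>>
in s ([disc_system]).  For each r > 0 other than 1 the product of its roots is
negative, so exactly one of them is positive: [profile r], which tends to 0 when
r tends to 0 or to 1.  For r = 1 no root is positive.

For a fixed om, the points r om + w j with |w|^2 = [profile r] thus form a
circle for each r: those with r < 1 sweep a cylinder that is pinched at 0 and
at om, those with r > 1 a cylinder pinched at infinity and at om
([pinched_handle_handle], [Disc_scroll]).

The topology is controlled by a continuous map from the projective line to R^5,
the Hopf map [hopf], which sends [q1, q2] to |q1|^2 and q1^* q2, both divided by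
|q1|^2 + |q2|^2.  It gives continuous inverses for the parametrizations of the
handles and for the stereographic projection. *)

(** * Maps between subsets, and continuity of formulas *)

Lemma continuous_set_type (X T : topologicalType) (A : set X) (f : T -> A) :
  continuous (\val \o f) -> continuous f.
Proof.
move=> /continuousP cf; apply/continuousP => _ [V oV <-].
exact: (cf V oV).
Qed.

(** Together with the lemmas below, this restates the continuity of the usual
    operations for functions written pointwise, the shape in which the
    [continuity] tactic decomposes a formula. *)
Lemma continuous_pair (T X Y : topologicalType) (f : T -> X) (g : T -> Y) t :
  {for t, continuous f} -> {for t, continuous g} ->
  {for t, continuous (fun x => (f x, g x))}.
Proof. exact: cvg_pair. Qed.

(** Both homeomorphisms needed, the one of the sphere and those of the
    cylinders, come from a pair of functions between the ambient spaces that
    are mutually inverse on the given subsets only. *)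
Lemma homeomorphism_set_type (X Y : topologicalType) (A : set X) (B : set Y)
    (f : X -> Y) (g : Y -> X) :
    {within A, continuous f} -> {within B, continuous g} ->
    (forall x, A x -> B (f x)) -> (forall y, B y -> A (g y)) ->
    (forall x, A x -> g (f x) = x) -> (forall y, B y -> f (g y) = y) ->
  exists2 h : A -> B, homeomorphism h & forall a, \val (h a) = f (\val a).
Proof.
move=> /subspace_sigL_continuousP cf /subspace_sigL_continuousP cg.
move=> fAB gBA fK gK.
have fS (a : A) : f (\val a) \in B by apply/mem_set/fAB/set_mem/(valP a).
have gS (b : B) : g (\val b) \in A by apply/mem_set/gBA/set_mem/(valP b).
exists (fun a => SigSub (fS a)) => //; split.
  exact: continuous_set_type.
exists (fun b => SigSub (gS b)); split.
- exact: continuous_set_type.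
- by move=> a; apply: val_inj => /=; apply/fK/set_mem/(valP a).
- by move=> b; apply: val_inj => /=; apply/gK/set_mem/(valP b).
Qed.

(** Continuity on a subset for a function that is given there by several
    formulas, each valid on a relatively open part: one formula near each
    point is enough. *)
Lemma cvg_within_eq_on (T U : topologicalType) (A B : set T) (f g : T -> U) p :
    open B -> B p -> A p -> (forall x, A x -> B x -> f x = g x) ->
  {for p, continuous g} -> f x @[x --> within A (nbhs p)] --> f p.
Proof.
move=> oB Bp Ap fg cg V; rewrite (fg p Ap Bp) => /cg.
apply: filterS2 (open_nbhs_nbhs (conj oB Bp)) => x Bx + Ax.
by rewrite /= (fg x Ax Bx).
Qed.

Section RealContinuity.
Variable R : realType.

Lemma continuous_addr (T : topologicalType) (t : T) (f g : T -> R) :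
  {for t, continuous f} -> {for t, continuous g} ->
  {for t, continuous (fun x => f x + g x)}.
Proof. exact: continuousD. Qed.

Lemma continuous_mulr (T : topologicalType) (t : T) (f g : T -> R) :
  {for t, continuous f} -> {for t, continuous g} ->
  {for t, continuous (fun x => f x * g x)}.
Proof. exact: continuousM. Qed.

Lemma continuous_oppr (T : topologicalType) (t : T) (f : T -> R) :
  {for t, continuous f} ->
  {for t, continuous (fun x => - f x)}.
Proof. exact: continuousN. Qed.

Lemma continuous_invr (T : topologicalType) (t : T) (f : T -> R) : f t != 0 ->
  {for t, continuous f} ->
  {for t, continuous (fun x => (f x)^-1)}.
Proof. exact: continuousV. Qed.

Lemma continuous_exprn (T : topologicalType) (t : T) (f : T -> R) n :
  {for t, continuous f} ->
  {for t, continuous (fun x => f x ^+ n)}.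
Proof.
move=> cf; elim: n => [|n IH].
  rewrite (_ : (fun x => _) = fun=> 1); first exact: cst_continuous.
  by apply/funext => x; rewrite expr0.
rewrite (_ : (fun x => _) = fun x => f x * f x ^+ n).
  exact: continuous_mulr.
by apply/funext => x; rewrite exprS.
Qed.

Lemma continuous_fst_comp (T X Y : topologicalType) (t : T) (f : T -> X * Y) :
  {for t, continuous f} ->
  {for t, continuous (fun x => (f x).1)}.
Proof. move=> cf; exact: (continuous_comp cf (@cvg_fst _ _ _ _ _)). Qed.

Lemma continuous_snd_comp (T X Y : topologicalType) (t : T) (f : T -> X * Y) :
  {for t, continuous f} ->
  {for t, continuous (fun x => (f x).2)}.
Proof. move=> cf; exact: (continuous_comp cf (@cvg_snd _ _ _ _ _)). Qed.

Lemma continuous_sqrtr (T : topologicalType) (t : T) (f : T -> R) :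
  {for t, continuous f} -> {for t, continuous (fun x => Num.sqrt (f x))}.
Proof. by move=> cf; exact: (continuous_comp cf (@sqrt_continuous R _)). Qed.

End RealContinuity.

(** The head symbol of the formula decides the lemma to apply: letting
    unification choose would unfold the operations of the ring and of the
    product topologies. The goals left over are the nonvanishing conditions of
    the inverses. *)
Ltac continuity_at x f :=
  change (continuous_at x f);
  lazymatch f with
  | fun y => y => exact: cvg_id
  | fun y => @fst _ _ (@?g y) => refine (@continuous_fst_comp _ _ _ _ g _)
  | fun y => @snd _ _ (@?g y) => refine (@continuous_snd_comp _ _ _ _ g _)
  | fun y => @pair _ _ (@?g y) (@?h y) =>
      refine (@continuous_pair _ _ _ g h _ _ _)
  | fun y => @GRing.exp _ (@?g y) ?n => refine (@continuous_exprn _ _ _ g n _)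
  | fun y => @GRing.add _ (@?g y) (@?h y) =>
      refine (@continuous_addr _ _ _ g h _ _)
  | fun y => @GRing.mul _ (@?g y) (@?h y) =>
      refine (@continuous_mulr _ _ _ g h _ _)
  | fun y => @GRing.opp _ (@?g y) => refine (@continuous_oppr _ _ _ g _)
  | fun y => @GRing.inv _ (@?g y) => refine (@continuous_invr _ _ _ g _ _)
  | fun y => @Num.sqrt _ (@?g y) => refine (@continuous_sqrtr _ _ _ g _)
  | fun y => ?c => exact: cst_continuous
  | fun y => ?g y => assumption
  | _ => assumption
  end.
Ltac continuity_step :=
  lazymatch goal with
  | |- @prop_for _ ?x (fun z => continuous_at z ?f) _ => continuity_at x f
  | |- continuous_at ?x ?f => continuity_at x f
  end.
Ltac continuity := repeat continuity_step.

(** Stated for arbitrary coordinate functions, so that the products of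
    topologies are not unfolded for each of the many occurrences of the
    coordinates. *)
Lemma continuous_hopf_formula (R : realType) (T : topologicalType) (t : T)
    (a b c d a' b' c' d' : T -> R) :
    {for t, continuous a} -> {for t, continuous b} ->
    {for t, continuous c} -> {for t, continuous d} ->
    {for t, continuous a'} -> {for t, continuous b'} ->
    {for t, continuous c'} -> {for t, continuous d'} ->
  let n x := a x ^+ 2 + b x ^+ 2 + c x ^+ 2 + d x ^+ 2
         + (a' x ^+ 2 + b' x ^+ 2 + c' x ^+ 2 + d' x ^+ 2) in
  n t != 0 -> {for t, continuous (fun x =>
  ((a x ^+ 2 + b x ^+ 2 + c x ^+ 2 + d x ^+ 2) / n x,
   ((a x * a' x + b x * b' x + c x * c' x + d x * d' x) / n x,
    (a x * b' x - b x * a' x - c x * d' x + d x * c' x) / n x,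
    (a x * c' x + b x * d' x - c x * a' x - d x * b' x) / n x,
    (a x * d' x - b x * c' x + c x * b' x - d x * a' x) / n x)))}.
Proof.
move=> ca cb cc cd ca' cb' cc' cd' n n0.
have cn : {for t, continuous n} by rewrite /n; continuity.
clearbody n; by continuity.
Qed.

(** * Counting points *)

Lemma card_set_uniq (T : choiceType) (s : seq T) :
  uniq s -> ([set` s] #= `I_(size s))%card.
Proof.
elim: s => [_|x s IH /= /andP[xs us]].
  rewrite (_ : [set` _] = set0); last by apply/seteqP; split.
  by rewrite II0 card_eq00.
apply/eq_cardSP; exists x; first by rewrite /= mem_head.
rewrite (_ : _ `\ x = [set` s]); first exact: IH.
apply/seteqP; split=> y /=; rewrite inE.
  by case=> /orP[/eqP ->|//].
by move=> ys; rewrite ys orbT; split=> // yx; rewrite -yx ys in xs.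
Qed.

(** Counts the points of a set given by a list that may have repetitions, such
    as the list of the three roots of a cubic. *)
Lemma card_set_seq (T : choiceType) (s : seq T) n :
  ([set` s] #= `I_n)%card = (size (undup s) == n).
Proof.
have -> : [set` s] = [set` undup s].
  by apply/seteqP; split=> x /=; rewrite mem_undup.
have := card_set_uniq (undup_uniq s) => /card_eql ->.
by apply/card_eq_II/eqP.
Qed.

(** Excludes the fibres that the surface contains. *)
Lemma infinite_image_nat (T : Type) (A : set T) (f : nat -> T) n :
  injective f -> (forall k, A (f k)) -> ~ (A #= `I_n)%card.
Proof.
move=> fI fA An; apply: infinite_nat.
have : finite_set (range f).
  apply: (@sub_finite_set _ _ A); first by move=> _ [k _ <-].
  by apply/finite_setP; exists n.
by rewrite (eq_finite_set (inj_card_eq (in2W fI))).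
Qed.

Lemma card_eq_seq (T : choiceType) (A : set T) n : (A #= `I_n)%card ->
  exists2 s : seq T, uniq s & size s = n /\ A = [set` s].
Proof.
move=> An; have Af : finite_set A by apply/finite_setP; exists n.
exists (finmap.enum_fset (fset_set A)); first exact: finmap.fset_uniq.
split; first exact: card_fset_set.
by rewrite -[LHS]fset_setK.
Qed.

Lemma card_setX (T U : choiceType) (A : set T) (B : set U) m n :
  (A #= `I_m)%card -> (B #= `I_n)%card -> (A `*` B #= `I_(m * n))%card.
Proof.
move=> /card_eq_seq[s us [sm ->]] /card_eq_seq[t ut [tn ->]].
rewrite (_ : _ `*` _ = [set` [seq (x, y) | x <- s, y <- t]]).
  rewrite -sm -tn -(size_allpairs pair); apply: card_set_uniq.
  by apply: allpairs_uniq => // -[? ?] [? ?].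
apply/seteqP; split=> [[x y] [/= xs yt]|_ /allpairsP[[x y] [xs yt ->]]//].
by apply/allpairsP; exists (x, y).
Qed.

(** * The quaternionic projective line and its two charts *)

Section HP1.
Variable R : realType.
Implicit Types (q : quat R) (x : HP1 R).

Lemma hp_classP (u v : quat R * quat R) (u0 : u <> (0, 0)) (v0 : v <> (0, 0)) :
  hp_class u0 = hp_class v0 <->
  exists2 p : quat R, p != 0 & v = (p * u.1, p * u.2).
Proof.
by split=> [/eqmodP/asboolP//|uv]; apply/eqmodP/asboolP.
Qed.

Lemma pi_hp_class (u : quat R * quat R) (u0 : u \in nzpair R) :
  \pi_(HP1 R) (SigSub u0) = hp_class (set_mem u0).
Proof. by congr (\pi _); apply: val_inj. Qed.

Lemma hp_affine_inj : injective (@hp_affine R).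
Proof.
move=> q q' /hp_classP[p _ [p1 ->]].
by rewrite -[p]mulr1 -p1 mul1r.
Qed.

Lemma hp_affine_neq_infty q : hp_affine q <> hp_infty R.
Proof.
move=> /hp_classP[p /[swap]] [p1 _] /eqP; apply.
by rewrite p1 mulr1.
Qed.

Lemma coaffine_neq0 q : (q, 1) <> (0, 0) :> quat R * quat R.
Proof. by case=> _ /eqP; rewrite oner_eq0. Qed.

(** The chart centred at infinity. *)
Definition hp_coaffine q : HP1 R := hp_class (@coaffine_neq0 q).

Lemma hp_coaffine0 : hp_coaffine 0 = hp_infty R.
Proof. by apply/hp_classP; exists 1; rewrite ?oner_neq0//= !mul1r. Qed.

Lemma hp_coaffineV q : q != 0 -> hp_coaffine q^-1 = hp_affine q.
Proof.
by move=> q0; apply/hp_classP; exists q => //=; rewrite divrr// mulr1.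
Qed.

Lemma hp_classE (u : quat R * quat R) (u0 : u <> (0, 0)) : hp_class u0 =
  if u.1 == 0 then hp_infty R else hp_affine (u.1^-1 * u.2).
Proof.
case: ifPn => [/eqP|] u1.
  have u2 : u.2 != 0.
    by apply: contra_notN u0 => /eqP u2; rewrite [u]surjective_pairing u1 u2.
  apply/esym/hp_classP; exists u.2 => //=.
  by rewrite mulr0 mulr1 -u1 -surjective_pairing.
apply/esym/hp_classP; exists u.1 => //=.
by rewrite mulr1 mulVKr -?surjective_pairing.
Qed.

Lemma HP1_ind (P : HP1 R -> Prop) :
  P (hp_infty R) -> (forall q, P (hp_affine q)) -> forall x, P x.
Proof.
move=> Poo Paff x; rewrite -[x]reprK; case: (repr x) => u u0.
by rewrite pi_hp_class hp_classE; case: ifP.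
Qed.

Lemma continuous_hp_affine : continuous (@hp_affine R).
Proof.
have c : continuous (fun q =>
    SigSub (mem_set (@affine_neq0 R q) : (1, q) \in nzpair R) : nzpair R).
  apply: continuous_set_type => q.
  have H : {for q, continuous (fun x : quat R => (1 : quat R, x))}.
    by apply: continuous_pair; [exact: cst_continuous|exact: cvg_id].
  exact: H.
move=> q; exact: (continuous_comp (c q) (@pi_continuous _ _ _)).
Qed.

Lemma continuous_hp_coaffine : continuous hp_coaffine.
Proof.
have c : continuous (fun q =>
    SigSub (mem_set (@coaffine_neq0 q) : (q, 1) \in nzpair R) : nzpair R).
  apply: continuous_set_type => q.
  have H : {for q, continuous (fun x : quat R => (x, 1 : quat R))}.
    by apply: continuous_pair; [exact: cvg_id|exact: cst_continuous].
  exact: H.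
move=> q; exact: (continuous_comp (c q) (@pi_continuous _ _ _)).
Qed.

Definition qnorm2 q : R :=
  let: (a, b, c, d) := q in a ^+ 2 + b ^+ 2 + c ^+ 2 + d ^+ 2.

Lemma qnorm2M p q : qnorm2 (p * q) = qnorm2 p * qnorm2 q.
Proof.
by case: p q => [[[? ?] ?] ?] [[[? ?] ?] ?]; rewrite /qnorm2 /=; ring.
Qed.

Lemma qnorm2_ge0 q : 0 <= qnorm2 q.
Proof. by case: q => [[[? ?] ?] ?]; rewrite /= !addr_ge0 ?sqr_ge0. Qed.

Lemma qnorm2_eq0 q : (qnorm2 q == 0) = (q == 0).
Proof.
apply/eqP/eqP => [|->]; last by rewrite /= expr0n /= !addr0.
case: q => [[[a b] c] d] /= n0.
have sq0 (x : R) : x ^+ 2 = 0 -> x = 0 by move/eqP; rewrite sqrf_eq0 => /eqP.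
have := (sqr_ge0 a, sqr_ge0 b, sqr_ge0 c, sqr_ge0 d) => -[[[a0 b0] c0] d0].
have [aE bE] : a = 0 /\ b = 0 by split; apply: sq0; lra.
have [cE dE] : c = 0 /\ d = 0 by split; apply: sq0; lra.
by rewrite aE bE cE dE.
Qed.

Lemma qnorm2V q : qnorm2 q^-1 = (qnorm2 q)^-1.
Proof.
have [->|q0] := eqVneq q 0; first by rewrite invr0 /= expr0n /= !addr0 invr0.
have n0 : qnorm2 q != 0 by rewrite qnorm2_eq0.
by apply: (mulfI n0); rewrite -qnorm2M divrr ?divff //= expr0n expr1n /= !addr0.
Qed.

(** Hopf's fibration: up to the normalization of the first coordinate this is
    the map from the 7-sphere to the 4-sphere. *)
Definition hopf_pair (u : quat R * quat R) : R * quat R :=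
  let a := u.1.1.1.1 in let b := u.1.1.1.2 in
  let c := u.1.1.2 in let d := u.1.2 in
  let a' := u.2.1.1.1 in let b' := u.2.1.1.2 in
  let c' := u.2.1.2 in let d' := u.2.2 in
  let n := a ^+ 2 + b ^+ 2 + c ^+ 2 + d ^+ 2
         + (a' ^+ 2 + b' ^+ 2 + c' ^+ 2 + d' ^+ 2) in
  ((a ^+ 2 + b ^+ 2 + c ^+ 2 + d ^+ 2) / n,
   ((a * a' + b * b' + c * c' + d * d') / n,
    (a * b' - b * a' - c * d' + d * c') / n,
    (a * c' + b * d' - c * a' - d * b') / n,
    (a * d' - b * c' + c * b' - d * a') / n)).

(** Replacing [q1, q2] by [p q1, p q2] multiplies |q1|^2, |q2|^2 and q1^* q2
    by the same real number |p|^2. *)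
Lemma hopf_pairM p u1 u2 :
  p != 0 -> hopf_pair (p * u1, p * u2) = hopf_pair (u1, u2).
Proof.
rewrite -qnorm2_eq0 => p0.
have E : hopf_pair (p * u1, p * u2) =
    let: ((a, b, c, d), (a', b', c', d')) := (u1, u2) in
    let n := qnorm2 p * (qnorm2 u1 + qnorm2 u2) in
    (qnorm2 p * qnorm2 u1 / n,
     (qnorm2 p * (a * a' + b * b' + c * c' + d * d') / n,
      qnorm2 p * (a * b' - b * a' - c * d' + d * c') / n,
      qnorm2 p * (a * c' + b * d' - c * a' - d * b') / n,
      qnorm2 p * (a * d' - b * c' + c * b' - d * a') / n)).
  rewrite mulrDr -!qnorm2M /hopf_pair.
  case: p p0 u1 u2 => [[[? ?] ?] ?] _ [[[? ?] ?] ?] [[[? ?] ?] ?].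
  by congr (_, (_, _, _, _)) => /=; congr (_ / _); ring.
rewrite E /hopf_pair; case: u1 u2 {E} => [[[? ?] ?] ?] [[[? ?] ?] ?].
by rewrite -!mulf_div divff// !mul1r.
Qed.

Definition hopf : HP1 R -> R * quat R := (hopf_pair \o \val) \o repr.

Lemma hopf_class (u : quat R * quat R) (u0 : u <> (0, 0)) :
  hopf (hp_class u0) = hopf_pair u.
Proof.
rewrite /hopf /=.
have : \pi_(HP1 R) (repr (hp_class u0)) = hp_class u0 by rewrite reprK.
case: (repr _) => v v0; rewrite pi_hp_class => /hp_classP[p p0 ->].
by rewrite hopf_pairM// -surjective_pairing.
Qed.

Lemma continuous_hopf_pair (u : quat R * quat R) : u <> (0, 0) ->
  {for u, continuous hopf_pair}.
Proof.
move=> u0.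
have n0 : qnorm2 u.1 + qnorm2 u.2 != 0.
  rewrite paddr_eq0 ?qnorm2_ge0// !qnorm2_eq0.
  apply: contra_notN u0 => /andP[/eqP u1 /eqP u2].
  by rewrite [u]surjective_pairing u1 u2.
apply: continuous_hopf_formula; rewrite /=.
1-8: continuity.
by move: n0; case: {+}u => [[[[? ?] ?] ?] [[[? ?] ?] ?]].
Qed.

Lemma continuous_hopf : continuous hopf.
Proof.
apply: repr_comp_continuous => [u|u v /eqP].
  apply: (continuous_comp (@initial_continuous _ _ _ u)).
  by apply: continuous_hopf_pair; exact/set_mem/(valP u).
case: u v => u u0 [v v0] uv.
rewrite !pi_hp_class in uv; have /hp_classP[p p0] := uv.
by move=> /= ->; rewrite hopf_pairM// -surjective_pairing.
Qed.

(** Dividing the second component of [hopf] by the first recovers q1^-1 q2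
    wherever q1 is nonzero. *)
Definition affine_coord x : quat R :=
  let: (d, (a, b, c, e)) := hopf x in (a / d, b / d, c / d, e / d).

Lemma hopf_affine q : hopf (hp_affine q) =
  let n := 1 + qnorm2 q in
  (n^-1, (q.1.1.1 / n, q.1.1.2 / n, q.1.2 / n, q.2 / n)).
Proof.
rewrite /hp_affine hopf_class.
case: q => [[[a b] c] d]; rewrite /hopf_pair /= expr0n expr1n /=.
by rewrite !mul0r !mul1r !addr0 !subr0 mul1r.
Qed.

Lemma hp_affineK : cancel (@hp_affine R) affine_coord.
Proof.
move=> q; rewrite /affine_coord hopf_affine /=.
have n0 : 1 + qnorm2 q != 0 by rewrite gt_eqF// ltr_pwDl// qnorm2_ge0.
case: q n0 => [[[a b] c] d] /= n0.
by rewrite !invrK !divfK.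
Qed.

Lemma continuous_affine_coord q : {for hp_affine q, continuous affine_coord}.
Proof.
have -> : affine_coord = (fun u : R * quat R =>
    (u.2.1.1.1 / u.1, u.2.1.1.2 / u.1, u.2.1.2 / u.1, u.2.2 / u.1)
    : quat R) \o hopf.
  apply/funext => x; rewrite /affine_coord /=.
  by case: (hopf x) => [? [[[? ?] ?] ?]].
apply: continuous_comp; first exact: continuous_hopf.
continuity.
all: by rewrite hopf_affine /= invr_eq0 gt_eqF// ltr_pwDl// qnorm2_ge0.
Qed.

End HP1.

(** * The Riemann sphere in the projective line *)

Section Sphere.
Variable R : realType.
Implicit Types (q : quat R) (x : HP1 R).

Lemma ChatP x : Chat R x <->
  x = hp_infty R \/ exists a b : R, x = hp_affine (a, b, 0, 0).
Proof.
split=> [[[[a b] _ <-]|->]|[->|[a [b ->]]]]; [right|left|right|left] => //.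
- by exists a, b.
- by exists (a +i* b)%C.
Qed.

Lemma hopf_infty : hopf (hp_infty R) = (0, (0, 0, 0, 0)).
Proof.
rewrite /hp_infty hopf_class /hopf_pair /= !expr0n /=.
by rewrite !mul0r !addr0 !subr0 !mul0r.
Qed.

Lemma sphere2_south (x y : R) : sphere2 R (x, y, -1) -> x = 0 /\ y = 0.
Proof.
rewrite /sphere2 /= => S; have := (sqr_ge0 x, sqr_ge0 y) => -[x2 y2].
by split; apply/eqP; rewrite -sqrf_eq0; apply/eqP; lra.
Qed.

Lemma sphere2_ratio (x y h : R) : sphere2 R (x, y, h) -> 1 + h != 0 ->
  (x / (1 + h)) ^+ 2 + (y / (1 + h)) ^+ 2 = (1 - h) / (1 + h).
Proof.
rewrite /sphere2 /= => S h0.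
transitivity ((1 - h ^+ 2) / (1 + h) ^+ 2); last by field.
by rewrite !expr_div_n -mulrDl; congr (_ / _); lra.
Qed.

Lemma one_add_sqrs_neq0 (a b : R) : 1 + (a ^+ 2 + b ^+ 2) != 0.
Proof. by rewrite gt_eqF// ltr_pwDl// addr_ge0// sqr_ge0. Qed.

(** Stereographic projection from the south pole, which itself goes to
    infinity. *)
Definition stereo (p : R * R * R) : HP1 R :=
  if p.2 == -1 then hp_infty R
  else hp_affine (p.1.1 / (1 + p.2), p.1.2 / (1 + p.2), 0, 0).

(** On the Riemann sphere the components d and N of [hopf], with N complex,
    satisfy |N|^2 = d (1 - d), the equation of a sphere of centre 1/2 and
    radius 1/2; this rescales it to the unit sphere. *)
Definition stereo_inv x : R * R * R :=
  (2 * (hopf x).2.1.1.1, 2 * (hopf x).2.1.1.2, 2 * (hopf x).1 - 1).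

Lemma stereo_inv_affine (a b : R) (n := 1 + (a ^+ 2 + b ^+ 2)) :
  stereo_inv (hp_affine (a, b, 0, 0)) = (2 * (a / n), 2 * (b / n), 2 / n - 1).
Proof. by rewrite /stereo_inv hopf_affine /= expr0n /= !addr0. Qed.

Lemma stereo_inv_infty : stereo_inv (hp_infty R) = (0, 0, -1).
Proof. by rewrite /stereo_inv hopf_infty /= !mulr0 sub0r. Qed.

Lemma stereoK p : sphere2 R p -> stereo_inv (stereo p) = p.
Proof.
case: p => [[x y] h]; rewrite /stereo /= => S.
have [h1|h1] := eqVneq h (-1).
  rewrite h1 in S *; have [-> ->] := sphere2_south S.
  exact: stereo_inv_infty.
have h0 : 1 + h != 0 by rewrite addrC addr_eq0.
rewrite stereo_inv_affine sphere2_ratio//.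
have -> : 1 + (1 - h) / (1 + h) = 2 / (1 + h) by field.
by congr (_, _, _); field.
Qed.

Lemma sphere2_stereo_inv x : Chat R x -> sphere2 R (stereo_inv x).
Proof.
move=> /ChatP[->|[a [b ->]]]; rewrite /sphere2 /mkset.
  by rewrite stereo_inv_infty /= sqrrN expr1n expr0n /= !add0r.
rewrite stereo_inv_affine /=.
have n0 := one_add_sqrs_neq0 a b.
by field.
Qed.

Lemma Chat_stereo p : Chat R (stereo p).
Proof.
apply/ChatP; rewrite /stereo; case: ifP => _; first by left.
by right; exists (p.1.1 / (1 + p.2)), (p.1.2 / (1 + p.2)).
Qed.

Lemma stereo_invK x : Chat R x -> stereo (stereo_inv x) = x.
Proof.
move=> /ChatP[->|[a [b ->]]]; first by rewrite stereo_inv_infty /stereo /= eqxx.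
have n0 := one_add_sqrs_neq0 a b.
rewrite stereo_inv_affine /stereo /= -subr_eq0 opprK (addrC 1 (_ - 1)) subrK.
rewrite mulf_eq0 invr_eq0 (negbTE n0) pnatr_eq0 /=.
by congr (hp_affine (_, _, _, _)); field.
Qed.

Lemma continuous_stereo_inv : continuous stereo_inv.
Proof.
move=> x.
pose g (u : R * quat R) := (2 * u.2.1.1.1, 2 * u.2.1.1.2, 2 * u.1 - 1).
have c : {for hopf x, continuous g}.
  by rewrite /g; continuity.
exact: (continuous_comp (@continuous_hopf _ x) c).
Qed.

(** The chart at infinity extends the projection over the south pole: on the
    sphere (x + i y) / (1 + h) and (x - i y) / (1 - h) are inverse to each
    other. *)
Lemma stereo_south p : sphere2 R p -> p.2 != 1 ->
  stereo p = hp_coaffine (p.1.1 / (1 - p.2), - p.1.2 / (1 - p.2), 0, 0).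
Proof.
case: p => [[x y] h] /=; rewrite /stereo /= => S h1.
have [hm1|hm1] := eqVneq h (-1).
  rewrite hm1 in S; have [-> ->] := sphere2_south S.
  by rewrite oppr0 !mul0r -hp_coaffine0.
have hp0 : 1 + h != 0 by rewrite addrC addr_eq0.
have hm0 : 1 - h != 0 by rewrite subr_eq0 eq_sym.
have E := sphere2_ratio S hp0.
rewrite -hp_coaffineV.
  congr hp_coaffine.
  have -> q : q^-1 = qinv q by [].
  rewrite /qinv expr0n /= !addr0 E oppr0 mul0r.
  by congr (_, _, _, _); field; rewrite hp0 hm0.
by rewrite -qnorm2_eq0 /= expr0n /= !addr0 E mulf_neq0// invr_neq0.
Qed.

Lemma continuous_within_stereo : {within sphere2 R, continuous stereo}.
Proof.
have ch p : {for p, continuous (snd : R * R * R -> R)} by exact: cvg_snd.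
have onh (r : R) : open [set p : R * R * R | p.2 != r].
  by move/continuousP: ch => /(_ _ (@open_neq _ r)).
apply/subspace_continuousP => p Sp.
have [h1|h1] := eqVneq p.2 (-1).
- have n1 : p.2 != 1 by rewrite h1; apply/eqP => ?; lra.
  apply: (cvg_within_eq_on (onh 1) n1 Sp stereo_south).
  have c : {for p, continuous (fun q : R * R * R =>
      (q.1.1 / (1 - q.2), - q.1.2 / (1 - q.2), 0, 0) : quat R)}.
    by continuity; rewrite subr_eq0 eq_sym.
  exact: (continuous_comp c (@continuous_hp_coaffine _ _)).
- have north (q : R * R * R) : sphere2 R q -> q.2 != -1 -> stereo q =
      hp_affine (q.1.1 / (1 + q.2), q.1.2 / (1 + q.2), 0, 0).
    by move=> _; rewrite /stereo => /negbTE ->.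
  apply: (cvg_within_eq_on (onh (-1)) h1 Sp north).
  have c : {for p, continuous (fun q : R * R * R =>
      (q.1.1 / (1 + q.2), q.1.2 / (1 + q.2), 0, 0) : quat R)}.
    by continuity; rewrite addrC addr_eq0.
  exact: (continuous_comp c (@continuous_hp_affine _ _)).
Qed.

Theorem homeomorphic_sphere2_Chat : homeomorphic (sphere2 R) (Chat R).
Proof.
have [h hh _] := homeomorphism_set_type continuous_within_stereo
  (continuous_subspaceT continuous_stereo_inv) (fun p _ => Chat_stereo p)
  sphere2_stereo_inv stereoK stereo_invK.
by exists h.
Qed.

End Sphere.

(** * The discriminant of a cubic *)

Section Cubic.
Variable F : numClosedFieldType.
Implicit Types a b c d x y z t : F.

Definition discriminant3 a b c d : F :=
  b ^+ 2 * c ^+ 2 - 4 * a * c ^+ 3 - 4 * b ^+ 3 * d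
  - 27 * a ^+ 2 * d ^+ 2 + 18 * a * b * c * d.

(** Stated by evaluation rather than for polynomials: that is all that the
    count of roots and the formula for the discriminant use. *)
Lemma cubic_factor a b c d : a != 0 -> exists x y z, forall t,
  a * t ^+ 3 + b * t ^+ 2 + c * t + d = a * (t - x) * (t - y) * (t - z).
Proof.
move=> a0; pose q : {poly F} := b *: 'X^2 + c *: 'X + d%:P.
pose p : {poly F} := a *: 'X^3 + q.
have sq : (size q < 4)%N.
  rewrite (leq_ltn_trans (size_polyD _ _))// gtn_max size_polyC.
  rewrite (leq_ltn_trans (size_polyD _ _)) ?gtn_max.
    by case: (d != 0).
  by rewrite !(leq_ltn_trans (size_scale_leq _ _)) ?size_polyXn ?size_polyX.
have sp : size (a *: 'X^3) = 4%N by rewrite size_scale// size_polyXn.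
have szp : size p = 4%N by rewrite /p size_polyDl sp.
have lp : lead_coef p = a.
  by rewrite /p lead_coefDl ?sp// lead_coefZ lead_coefXn mulr1.
have [rs pE] := closed_field_poly_normal p.
have : size p = (size rs).+1.
  by rewrite pE lp size_scale// size_prod_XsubC.
rewrite szp => -[]; case: rs pE => [//|x [//|y [//|z [|//]]]] pE _.
exists x, y, z => t.
have -> : a * t ^+ 3 + b * t ^+ 2 + c * t + d = p.[t].
  by rewrite /p /q !hornerD !hornerZ !hornerXn hornerX hornerC !addrA.
rewrite pE lp !big_cons big_nil mulr1 hornerZ !hornerM !hornerXsubC.
by rewrite !mulrA.
Qed.

(** Evaluating at 0, 1 and -1 yields Vieta's formulas. *)
Lemma discriminant3_factor a b c d x y z :
    (forall t, a * t ^+ 3 + b * t ^+ 2 + c * t + d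
             = a * (t - x) * (t - y) * (t - z)) ->
  discriminant3 a b c d
    = a ^+ 4 * ((x - y) * (y - z) * (z - x)) ^+ 2.
Proof.
move=> fE; have [f0 [f1 fN1]] := (fE 0, (fE 1, fE (-1))).
have dE : d = - (a * x * y * z).
  transitivity (a * 0 ^+ 3 + b * 0 ^+ 2 + c * 0 + d); first by ring.
  by rewrite f0; ring.
have bE : b = - (a * (x + y + z)).
  apply: (@mulfI _ 2) => //.
  transitivity (a * 1 ^+ 3 + b * 1 ^+ 2 + c * 1 + d
    + (a * (-1) ^+ 3 + b * (-1) ^+ 2 + c * (-1) + d) - 2 * d); first by ring.
  by rewrite f1 fN1 dE; ring.
have cE : c = a * (x * y + y * z + z * x).
  apply: (@mulfI _ 2) => //.
  transitivity (a * 1 ^+ 3 + b * 1 ^+ 2 + c * 1 + d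
    - (a * (-1) ^+ 3 + b * (-1) ^+ 2 + c * (-1) + d) - 2 * a); first by ring.
  by rewrite f1 fN1; ring.
by rewrite /discriminant3 bE cE dE; ring.
Qed.

Lemma card_roots_cubic a b c d : a != 0 ->
  ([set t | a * t ^+ 3 + b * t ^+ 2 + c * t + d = 0] #= `I_3)%card
    = (discriminant3 a b c d != 0).
Proof.
move=> a0; have [x [y [z fE]]] := cubic_factor b c d a0.
rewrite (discriminant3_factor fE) mulf_eq0 !expf_eq0 (negbTE a0) /=.
have -> : [set t | a * t ^+ 3 + b * t ^+ 2 + c * t + d = 0]
   = [set` [:: x; y; z]].
  apply/seteqP; split=> t /=; rewrite fE !inE -!(subr_eq0 t).
    by move/eqP; rewrite !mulf_eq0 (negbTE a0) /= -!orbA.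
  by move=> H; apply/eqP; move: H; rewrite !mulf_eq0 (negbTE a0) /= -!orbA.
have := ltn_size_undup [:: x; y; z]; rewrite ltn_neqAle size_undup andbT /=.
move=> /(congr1 negb); rewrite !negbK card_set_seq => ->.
rewrite !inE !mulf_eq0 !subr_eq0 (eq_sym z x).
by case: (x == y); case: (y == z); case: (x == z).
Qed.

End Cubic.

(** * The radial profile of the handles *)

Section Profile.
Variable R : realType.
Implicit Types r s : R.

(** The discriminant of the cubic on the fibre over r om + w j, with om^3 = -1
    and |w|^2 = s, up to sign and a factor w^2. *)
Definition disc_real r s :=
  27 * s ^+ 2 + 4 * r ^+ 2 * (9 - r) * s - 4 * r ^+ 3 * (r - 1) ^+ 2.

(** The larger root s of [disc_real r s]. *)
Definition profile r :=
  2 * (r ^+ 2 * (r - 9) + r * (r + 3) * Num.sqrt (r * (r + 3))) / 27.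

(** Completing the square: r (r - 9)^2 + 27 (r - 1)^2 = (r + 3)^3. *)
Lemma disc_real_square r s : 0 <= r ->
  27 * disc_real r s = (27 * s - 2 * r ^+ 2 * (r - 9)) ^+ 2
    - (2 * r * (r + 3) * Num.sqrt (r * (r + 3))) ^+ 2.
Proof.
move=> r0; rewrite [X in _ - X]exprMn sqr_sqrtr ?mulr_ge0 ?addr_ge0//.
by rewrite /disc_real; ring.
Qed.

Lemma profile_radical_ge0 r : 0 <= r ->
  0 <= 2 * r * (r + 3) * Num.sqrt (r * (r + 3)).
Proof. by move=> r0; rewrite !mulr_ge0 ?sqrtr_ge0 ?addr_ge0. Qed.

(** The difference of the squares is minus the product of the two roots of
    [disc_real r], up to a positive factor. Its sign tells that one root is
    positive and the other is not. *)
Lemma profile_gap r : 0 <= r ->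
  (2 * r * (r + 3) * Num.sqrt (r * (r + 3))) ^+ 2
    - (2 * r ^+ 2 * (r - 9)) ^+ 2 = 108 * (r * r * r) * (r - 1) ^+ 2.
Proof.
move=> r0; rewrite exprMn sqr_sqrtr ?mulr_ge0 ?addr_ge0//.
by ring.
Qed.

Lemma disc_real_root r s : 0 < r -> 0 < s -> disc_real r s = 0 -> s = profile r.
Proof.
move=> r0 s0 d0; have := disc_real_square s (ltW r0).
rewrite d0 mulr0 => /esym/eqP; rewrite subr_eq0 eqf_sqr => /orP[] /eqP E.
  by rewrite /profile; lra.
have B0 := profile_radical_ge0 (ltW r0).
(* the other root is not positive *)
suff : 2 * r ^+ 2 * (r - 9) <= 2 * r * (r + 3) * Num.sqrt (r * (r + 3)) by lra.
apply: (le_trans (ler_norm _)); rewrite -(ger0_norm B0) -ler_sqr ?nnegrE//.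
rewrite !real_normK ?num_real// -subr_ge0 (profile_gap (ltW r0)).
by apply: mulr_ge0 (sqr_ge0 _); rewrite !mulr_ge0 ?ltW.
Qed.

Lemma disc_real_profile r : 0 <= r -> disc_real r (profile r) = 0.
Proof.
move=> r0; apply: (@mulfI _ 27) => //; rewrite mulr0 disc_real_square//.
by apply/eqP; rewrite subr_eq0 /profile; apply/eqP; congr (_ ^+ 2); field.
Qed.

Lemma profile0 : profile 0 = 0.
Proof. by rewrite /profile expr0n /= !mul0r addr0 mulr0 mul0r. Qed.

Lemma profile1 : profile 1 = 0.
Proof.
rewrite /profile (_ : 1 * (1 + 3) = 2 ^+ 2); last by ring.
by rewrite sqrtr_sqr ger0_norm//; field.
Qed.

Lemma profile_gt0 r : 0 < r -> r != 1 -> 0 < profile r.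
Proof.
move=> r0 r1.
have B0 := profile_radical_ge0 (ltW r0); rewrite /profile.
suff : - (2 * r ^+ 2 * (r - 9)) < 2 * r * (r + 3) * Num.sqrt (r * (r + 3)).
  by lra.
apply: (le_lt_trans (ler_norm _)); rewrite -(ger0_norm B0) -ltr_sqr ?nnegrE//.
rewrite !real_normK ?num_real// sqrrN -subr_gt0 (profile_gap (ltW r0)).
apply: mulr_gt0; first by rewrite !mulr_gt0.
by rewrite exprn_even_gt0//= subr_eq0.
Qed.

Lemma continuous_profile : continuous profile.
Proof. by move=> r; rewrite /profile; continuity. Qed.

(** Real part of (a + b i)^3; the next one is its imaginary part. *)
Definition recube (a b : R) := a ^+ 3 - 3 * a * b ^+ 2.

Definition imcube (a b : R) := 3 * a ^+ 2 * b - b ^+ 3.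

Lemma cube_norm a b :
  recube a b ^+ 2 + imcube a b ^+ 2 = (a ^+ 2 + b ^+ 2) ^+ 3.
Proof. by rewrite /recube /imcube; ring. Qed.

(** The two equations say that the discriminant vanishes; s is the square of
    |w|. The imaginary part leaves two cases. If z^3 is real, then z^3 = r^3
    would make the real part positive, so z^3 = - r^3. If n + s = 1, then the
    real part and |z^3| = r^3 force r >= 1, against s > 0. *)
Lemma disc_system a b s : 0 < s -> let n := a ^+ 2 + b ^+ 2 in
    imcube a b * (1 - n - s) = 0 ->
    4 * (n + s + 1) * recube a b + 8 * n ^+ 2 + 36 * s * n + 27 * s ^+ 2 = 0 ->
  exists2 r, [/\ 0 < r, r != 1 & s = profile r] &
    [/\ r ^+ 2 = n, recube a b = - r ^+ 3 & imcube a b = 0].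
Proof.
move=> s0 n Im0 Re0.
have n0 : 0 <= n by rewrite addr_ge0 ?sqr_ge0.
have [r r0 rE] : exists2 r, 0 <= r & r ^+ 2 = n.
  by exists (Num.sqrt n); rewrite ?sqrtr_ge0 ?sqr_sqrtr.
have CN := cube_norm a b; rewrite -/n -rE in CN.
rewrite -rE in Re0 Im0 *; move/eqP: Im0.
rewrite mulf_eq0 => /orP[/eqP Y0|/eqP ns].
- move: CN; rewrite Y0 expr0n /= addr0 exprAC => /eqP.
  rewrite eqf_sqr => /orP[/eqP XE|/eqP XE].
    suff : 0 < 4 * (r ^+ 2 + s + 1) * recube a b + 8 * r ^+ 2 ^+ 2 +
        36 * s * r ^+ 2 + 27 * s ^+ 2 by rewrite Re0 ltxx.
    rewrite ltr_wpDl// ?mulr_gt0// ?exprn_gt0// XE.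
    by rewrite !addr_ge0// ?mulr_ge0 ?exprn_ge0 ?addr_ge0 ?exprn_ge0// ltW.
  have d0 : disc_real r s = 0.
    by rewrite -Re0 XE /disc_real; ring.
  have rp : 0 < r.
    rewrite lt_neqAle r0 andbT; apply/eqP => r00.
    have := exprn_gt0 2 s0; move: d0; rewrite /disc_real -r00; lra.
  exists r; split => //; last exact: disc_real_root.
  apply/eqP => r1; move: d0; rewrite r1 /disc_real.
  have := mulr_gt0 s0 s0; nra.
- exfalso.
  have sE : s = 1 - r ^+ 2 by lra.
  have X2 : - r ^+ 3 <= recube a b.
    rewrite lerNl; apply: (le_trans (ler_norm _)).
    rewrite -[leRHS]ger0_norm ?exprn_ge0// -ler_sqr ?nnegrE// normrN.
    rewrite !real_normK ?num_real//.
    have := sqr_ge0 (imcube a b); move: CN; rewrite (exprAC r 2 3); lra.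
  (* the product expands to r^4 + 8 r^3 + 18 r^2 - 27 *)
  have : 0 <= (r + 3) ^+ 3 * (r - 1).
    by move: Re0; rewrite sE; nra.
  rewrite pmulr_rge0 ?exprn_gt0 ?ltr_wpDl// subr_ge0 => r1.
  by move: s0; rewrite sE; nra.
Qed.

Lemma disc_systemV a b r : 0 <= r -> let n := a ^+ 2 + b ^+ 2 in
    r ^+ 2 = n -> recube a b = - r ^+ 3 -> let s := profile r in
    4 * (n + s + 1) * recube a b + 8 * n ^+ 2 + 36 * s * n + 27 * s ^+ 2 = 0.
Proof.
by move=> r0 n <- -> s; rewrite -(disc_real_profile r0) /disc_real -/s; ring.
Qed.

End Profile.

(** * Twistor fibres and their intersection with the scroll *)

Section TwistorFibres.
Variable R : realType.
Local Notation C := R[i].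
Implicit Types (q : quat R) (x y t : C) (X Y : 'rV[C]_4).

(** The quaternion x + y j. *)
Definition quat_of_C2 (x y : C) : quat R :=
  (complex.Re x, complex.Im x, complex.Re y, complex.Im y).

Lemma quat_of_C2_inj x y x' y' :
  quat_of_C2 x y = quat_of_C2 x' y' -> x = x' /\ y = y'.
Proof. by case: x y x' y' => [? ?] [? ?] [? ?] [? ?] [-> -> -> ->]. Qed.

Lemma quat_of_C2_eq0 x y : quat_of_C2 x y = 0 <-> x = 0 /\ y = 0.
Proof. by split=> [/(@quat_of_C2_inj x y 0 0)|[-> ->]]. Qed.

Lemma twistor_vecE X :
  twistor_vec X = (quat_of_C2 (X 0 0) (X 0 1), quat_of_C2 (X 0 2) (X 0 3)).
Proof.
suff E z w : quat_of_C z + quat_of_C w * qj R = quat_of_C2 z w.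
  by rewrite /twistor_vec !E.
by case: z w => [a b] [c d]; congr (_, _, _, _) => /=; ring.
Qed.

(** The components of q = z + w j are z = [qz q] and w = [qw q]. *)
Definition qz q : C := (q.1.1.1 +i* q.1.1.2)%C.

Definition qw q : C := (q.1.2 +i* q.2)%C.

(** The point of the twistor fibre over [1, q] with homogeneous coordinates x,
    y: the last two entries are the components of (x + y j) q. *)
Definition fibre_row q x y : 'rV[C]_4 :=
  \row_i [:: x; y; x * qz q - y * conjc (qw q);
                  x * qw q + y * conjc (qz q)]`_i.

Lemma row4P X Y : X 0 0 = Y 0 0 -> X 0 1 = Y 0 1 -> X 0 2 = Y 0 2 ->
  X 0 3 = Y 0 3 -> X = Y.
Proof.
move=> e0 e1 e2 e3; apply/rowP => -[[|[|[|[|//]]]] lt_k];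
  [move: e0|move: e1|move: e2|move: e3]; congr (X _ _ = Y _ _); exact: val_inj.
Qed.

Lemma twistor_vec_fibre X q :
  (twistor_vec X).2 = (twistor_vec X).1 * q <->
  X = fibre_row q (X 0 0) (X 0 1).
Proof.
have E : (twistor_vec X).1 * q =
    quat_of_C2 (fibre_row q (X 0 0) (X 0 1) 0 2)
               (fibre_row q (X 0 0) (X 0 1) 0 3).
  rewrite twistor_vecE !mxE /=.
  case: (X 0 0) (X 0 1) q => [a b] [c d] [[[e f] g] h].
  by congr (_, _, _, _) => /=; ring.
rewrite E twistor_vecE /=; split=> [|<-//].
by case/quat_of_C2_inj => e2 e3; apply: row4P => //; rewrite mxE.
Qed.

Definition cp_class X (X0 : X <> 0) : CP3 R :=
  \pi_(CP3 R) (SigSub (mem_set X0 : X \in nzvec R)).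

Lemma cp_classP X Y (X0 : X <> 0) (Y0 : Y <> 0) :
  cp_class X0 = cp_class Y0 <-> exists2 a : C, a != 0 & Y = a *: X.
Proof. by split=> [/eqmodP/asboolP//|XY]; apply/eqmodP/asboolP. Qed.

Lemma pi_cp_class X (X0 : X \in nzvec R) :
  \pi_(CP3 R) (SigSub X0) = cp_class (set_mem X0).
Proof. by congr (\pi _); apply: val_inj. Qed.

Lemma CP3_ind (P : CP3 R -> Prop) :
  (forall X (X0 : X <> 0), P (cp_class X0)) -> forall p, P p.
Proof.
move=> PX p; rewrite -[p]reprK; case: (repr p) => X X0.
by rewrite pi_cp_class; exact: PX.
Qed.

Lemma twistor_class X (X0 : X <> 0) : twistor (cp_class X0) =
  if (twistor_vec X).1 == 0 then hp_infty R
  else hp_affine ((twistor_vec X).1^-1 * (twistor_vec X).2).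
Proof. by rewrite /cp_class twistor_pi hp_classE. Qed.

Definition scroll_form X : C :=
  X 0 0 * X 0 3 ^+ 2 + X 0 1 ^+ 2 * X 0 2.

Lemma scroll_class X (X0 : X <> 0) :
  cubic_scroll R (cp_class X0) <-> scroll_form X = 0.
Proof.
split=> [[[Y Y0]] /= Y1|X1].
  rewrite pi_cp_class => /cp_classP[a a0 ->]; rewrite /scroll_form !mxE.
  transitivity (a ^+ 3 * scroll_form Y); first by rewrite /scroll_form; ring.
  by rewrite [scroll_form Y]Y1 mulr0.
by exists (SigSub (mem_set X0 : X \in nzvec R)).
Qed.

(** Homogeneous coordinates of the points of a projective line, [None] being
    the point at infinity. *)
Definition hcoord (o : option C) : C * C :=
  if o is Some t then (t, 1) else (1, 0).

Lemma fibre_row_neq0 q o : fibre_row q (hcoord o).1 (hcoord o).2 <> 0.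
Proof.
move=> /rowP e; have := e 0; have := e 1; rewrite !mxE /=.
by case: o {e} => [t|] /= /eqP e1 /eqP e0; move: e1 e0; rewrite ?oner_eq0.
Qed.

Definition fibre_point q o : CP3 R := cp_class (@fibre_row_neq0 q o).

Lemma fibre_row_coord q x y :
  (fibre_row q x y 0 0 = x) * (fibre_row q x y 0 1 = y).
Proof. by rewrite !mxE. Qed.

Lemma fibre_point_inj q : injective (fibre_point q).
Proof.
move=> o o' /cp_classP[a a0 /rowP e]; have := e 0; have := e 1.
rewrite !mxE /=; case: o o' {e} => [t|] [t'|] //=.
- by rewrite mulr1 => <-; rewrite mul1r => ->.
- by rewrite mulr1 => e; rewrite -e eqxx in a0.
- by rewrite mulr0 => /eqP; rewrite oner_eq0.
Qed.

Lemma twistor_fibre_point q o : twistor (fibre_point q o) = hp_affine q.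
Proof.
rewrite /fibre_point twistor_class; set X := fibre_row _ _ _.
have /twistor_vec_fibre E : X = fibre_row q (X 0 0) (X 0 1).
  by rewrite !fibre_row_coord.
case: ifPn => [/eqP|u0]; last by rewrite E mulKr.
rewrite twistor_vecE /= => /quat_of_C2_eq0; rewrite !fibre_row_coord.
by case: o {X E} => [t|] [] /= /eqP + /eqP; rewrite oner_eq0.
Qed.

Lemma fibre_pointP q p :
  twistor p = hp_affine q -> exists o, p = fibre_point q o.
Proof.
elim/CP3_ind: p => X X0; rewrite twistor_class.
case: ifPn => [_ /esym/hp_affine_neq_infty//|u0].
move=> /hp_affine_inj qE.
have XE : X = fibre_row q (X 0 0) (X 0 1).
  by apply/twistor_vec_fibre; rewrite -qE mulVKr.
have [y0|y0] := eqVneq (X 0 1) 0.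
  exists None; apply/esym/cp_classP; exists (X 0 0).
    apply: contra_neq u0 => x0.
    by rewrite twistor_vecE /=; apply/quat_of_C2_eq0.
  rewrite [LHS]XE y0; apply: row4P; rewrite !mxE /=; ring.
exists (Some (X 0 0 / X 0 1)); apply/esym/cp_classP; exists (X 0 1) => //.
by rewrite [LHS]XE; apply: row4P; rewrite !mxE /=; field.
Qed.

Definition fibre_form q o : C :=
  scroll_form (fibre_row q (hcoord o).1 (hcoord o).2).

Lemma fibre_scroll q : @twistor R @^-1` [set hp_affine q] `&` cubic_scroll R =
  fibre_point q @` [set o | fibre_form q o = 0].
Proof.
apply/seteqP; split=> [p [/= /fibre_pointP[m ->] /scroll_class o0]|].
  by exists m.
by move=> _ [m m0 <-]; split; [exact: twistor_fibre_point|exact/scroll_class].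
Qed.

Lemma Disc_affine q : Disc 3 (cubic_scroll R) (hp_affine q) <->
  ~ ([set o | fibre_form q o = 0] #= `I_3)%card.
Proof.
rewrite /Disc /mkset fibre_scroll.
by rewrite (card_eql (inj_card_eq (in2W (@fibre_point_inj q)))).
Qed.

Lemma Disc_infty : Disc 3 (cubic_scroll R) (hp_infty R).
Proof.
(* infinitely many points of the fibre over infinity, all on the scroll *)
pose X (t : C) : 'rV[C]_4 := \row_i [:: 0; 0; 1; t]`_i.
have X0 t : X t <> 0 by move=> /rowP/(_ 2)/eqP; rewrite !mxE /= oner_eq0.
apply: (@infinite_image_nat _ _ (fun n => cp_class (@X0 n%:R))).
  move=> m n /cp_classP[a a0 /rowP e]; have := e 3; have := e 2.
  rewrite !mxE /= mulr1 => <-; rewrite mul1r => /eqP.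
  by rewrite eqr_nat => /eqP.
move=> n; split.
  rewrite /= twistor_class twistor_vecE /= (_ : quat_of_C2 _ _ = 0) ?eqxx//.
  by apply/quat_of_C2_eq0; rewrite !mxE.
by apply/scroll_class; rewrite /scroll_form !mxE /= !mul0r expr0n mul0r addr0.
Qed.

End TwistorFibres.

(** * The discriminant locus outside the Riemann sphere *)

Section DiscLocus.
Variable R : realType.
Local Notation C := R[i].
Implicit Types (q : quat R) (x y t : C).

Lemma fibre_form_Some q t : fibre_form q (Some t) =
  qw q ^+ 2 * t ^+ 3 + (2 * qw q * conjc (qz q)) * t ^+ 2
    + (conjc (qz q) ^+ 2 + qz q) * t + - conjc (qw q).
Proof. by rewrite /fibre_form /scroll_form !mxE /=; ring. Qed.

Lemma fibre_form_None q : fibre_form q None = qw q ^+ 2.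
Proof. by rewrite /fibre_form /scroll_form !mxE /=; ring. Qed.

(** The form is a multiple of x y^2: its roots are x = 0 and y = 0, unless it
    vanishes on the whole fibre. *)
Lemma Disc_hp_of_C (z : C) : Disc 3 (cubic_scroll R) (hp_of_C z).
Proof.
apply/Disc_affine; set q := quat_of_C z.
have w0 : qw q = 0 by [].
have None0 : fibre_form q None = 0 by rewrite fibre_form_None w0 expr0n.
have SomeE t : fibre_form q (Some t) = (conjc (qz q) ^+ 2 + qz q) * t.
  by rewrite fibre_form_Some w0 conjc0; ring.
have [c0|c0] := eqVneq (conjc (qz q) ^+ 2 + qz q) 0.
  apply: (@infinite_image_nat _ _ (fun n => Some (n%:R : C))).
    by move=> m n [] /eqP; rewrite eqr_nat => /eqP.
  by move=> n; rewrite /= SomeE c0 mul0r.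
rewrite (_ : mkset _ = [set` [:: None; Some 0]]); first by rewrite card_set_seq.
apply/seteqP; split=> -[t|] /=; rewrite ?inE//=.
  by rewrite SomeE => /eqP; rewrite mulf_eq0 (negbTE c0).
by move/eqP=> [->]; rewrite SomeE mulr0.
Qed.

(** The leading coefficient w^2 is nonzero, so no root is at infinity. *)
Lemma Disc_discriminant3 q : qw q != 0 ->
  Disc 3 (cubic_scroll R) (hp_affine q) <->
  discriminant3 (qw q ^+ 2) (2 * qw q * conjc (qz q))
    (conjc (qz q) ^+ 2 + qz q) (- conjc (qw q)) = 0.
Proof.
move=> w0; rewrite Disc_affine.
have -> : [set o | fibre_form q o = 0] = Some @` [set t |
   qw q ^+ 2 * t ^+ 3 + (2 * qw q * conjc (qz q)) * t ^+ 2
    + (conjc (qz q) ^+ 2 + qz q) * t + - conjc (qw q) = 0].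
  apply/seteqP; split=> [[t|]|_ [t t0 <-]] /=.
  - by rewrite fibre_form_Some => t0; exists t.
  - by rewrite fibre_form_None => /eqP; rewrite sqrf_eq0 (negbTE w0).
  - by rewrite fibre_form_Some.
rewrite (card_eql card_some) card_roots_cubic ?sqrf_eq0//.
by split=> [/negP|->]; rewrite ?negbK ?eqxx// => /eqP.
Qed.

(** The conjugates zb and wb may be treated as independent variables. *)
Lemma discriminant3_fibre (z zb w wb : C) :
  discriminant3 (w ^+ 2) (2 * w * zb) (zb ^+ 2 + z) (- wb) = - w ^+ 2 *
    (4 * (z * zb + w * wb) * zb ^+ 3 + 4 * z ^+ 3 + 8 * (z * zb) ^+ 2
      + 36 * (w * wb) * (z * zb) + 27 * (w * wb) ^+ 2).
Proof. by rewrite /discriminant3; ring. Qed.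

Lemma cubeE (a b : R) : (a +i* b)%C ^+ 3 = (recube a b +i* imcube a b)%C.
Proof.
by rewrite !exprS expr0 mulr1 /recube /imcube; congr Complex => /=; ring.
Qed.

(** Since z z^* and w w^* are real, only the cubes have an imaginary part. *)
Lemma discriminant_ReIm (a b c d : R) (z := (a +i* b)%C) (w := (c +i* d)%C)
    (n := a ^+ 2 + b ^+ 2) (s := c ^+ 2 + d ^+ 2) :
  4 * (z * conjc z + w * conjc w) * conjc z ^+ 3 + 4 * z ^+ 3
    + 8 * (z * conjc z) ^+ 2 + 36 * (w * conjc w) * (z * conjc z)
    + 27 * (w * conjc w) ^+ 2 =
  ((4 * (n + s + 1) * recube a b + 8 * n ^+ 2 + 36 * s * n + 27 * s ^+ 2)
    +i* (4 * (imcube a b * (1 - n - s))))%C.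
Proof.
have natE k : k%:R = (k%:R +i* 0)%C :> C.
  by rewrite -(rmorph_nat (real_complex R)).
have zz : z * conjc z = (n +i* 0)%C by rewrite /z /n; congr Complex => /=; ring.
have ww : w * conjc w = (s +i* 0)%C by rewrite /w /s; congr Complex => /=; ring.
rewrite zz ww !cubeE !natE !expr2 /recube /imcube.
by congr Complex => /=; ring.
Qed.

(** For z = r om the cube om^3 is z^3 / r^3, which [disc_system] computes. *)
Lemma Disc_affineP q : qw q != 0 ->
  Disc 3 (cubic_scroll R) (hp_affine q) <-> exists r om,
   [/\ 0 < r, r != 1, om ^+ 3 = -1, qz q = r%:C%C * om &
       q.1.2 ^+ 2 + q.2 ^+ 2 = profile r].
Proof.
move=> w0; rewrite Disc_discriminant3// discriminant3_fibre.
case: q w0 => [[[a b] c] d] w0; rewrite /= [qz _]/= /qz /=.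
have s0 : 0 < c ^+ 2 + d ^+ 2.
  rewrite lt_neqAle addr_ge0 ?sqr_ge0// andbT eq_sym paddr_eq0 ?sqr_ge0//.
  rewrite !sqrf_eq0; apply: contra_neqN w0 => /andP[/eqP c0 /eqP d0].
  by rewrite /qw /= c0 d0.
rewrite [qw _]/= /qw /= discriminant_ReIm; split.
  move=> /eqP; rewrite mulf_eq0 oppr_eq0 sqrf_eq0 (negbTE w0) /=.
  move=> /eqP[Re0 Im0].
  have {}Im0 : imcube a b * (1 - (a ^+ 2 + b ^+ 2) - (c ^+ 2 + d ^+ 2)) = 0.
    by lra.
  have [r [r0 r1 sE] [rE ReE ImE]] := disc_system s0 Im0 Re0.
  have rn0 : r != 0 by rewrite gt_eqF.
  exists r, ((a / r) +i* (b / r))%C; split => //.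
  - rewrite cubeE; have -> : recube (a / r) (b / r) = recube a b / r ^+ 3.
      by rewrite /recube; field.
    have -> : imcube (a / r) (b / r) = imcube a b / r ^+ 3.
      by rewrite /imcube; field.
    rewrite ReE ImE mul0r mulNr divff ?expf_neq0//.
    by congr Complex; rewrite oppr0.
  - by congr Complex => /=; field.
case=> r [[x y] [r0 r1 om3 [aE bE] sE]].
have [X Y] : recube x y = -1 /\ imcube x y = 0.
  by move: om3; rewrite cubeE => -[-> ->]; rewrite oppr0.
have a' : a = r * x by rewrite aE; ring.
have b' : b = r * y by rewrite bE; ring.
have ReE : recube a b = - r ^+ 3.
  transitivity (r ^+ 3 * recube x y); last by rewrite X; ring.
  by rewrite a' b' /recube; ring.
have ImE : imcube a b = 0.
  transitivity (r ^+ 3 * imcube x y); last by rewrite Y mulr0.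
  by rewrite a' b' /imcube; ring.
have rE : r ^+ 2 = a ^+ 2 + b ^+ 2.
  apply/eqP; rewrite -(@eqrXn2 _ 3)// ?addr_ge0 ?sqr_ge0//.
  by rewrite -cube_norm ReE ImE; apply/eqP; ring.
rewrite ImE sE (disc_systemV (ltW r0) rE ReE) mul0r mulr0.
by rewrite (_ : (0 +i* 0)%C = 0)// mulr0.
Qed.

End DiscLocus.

(** * The pinched handles *)

Section Handles.
Variable R : realType.
Local Notation C := R[i].
Implicit Types (q : quat R) (z om : C) (P : HP1 R) (u : R * R).

(** Neighbourhoods for the product topology contain Euclidean balls. *)
Lemma nbhs_qnorm2 q0 (V : set (quat R)) : nbhs q0 V ->
  exists2 e : R, 0 < e & forall q, qnorm2 (q - q0) < e -> V q.
Proof.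
move=> nV; have /nbhs_ballP[e /= e0 eV] : nbhs (q0 : (R * R * R * R)%type) V.
  exact: nV.
exists (e ^+ 2); first exact: exprn_gt0.
have sqr_lt (x : R) : x ^+ 2 < e ^+ 2 -> `|x| < e.
  by move=> xe; rewrite -ltr_sqr ?nnegrE// ?ltW// real_normK ?num_real.
move=> q qe; apply: (eV q).
case: q q0 {nV eV} qe => [[[a b] c] d] [[[a0 b0] c0] d0] /= qe.
have := (sqr_ge0 (a - a0), sqr_ge0 (b - b0)) => -[A B].
have := (sqr_ge0 (c - c0), sqr_ge0 (d - d0)) => -[C0 D].
by split; [split; [split|]|]; rewrite /= /ball /= distrC; apply: sqr_lt; lra.
Qed.

Lemma nbhs_hp_affine q0 (U : set (HP1 R)) : nbhs (hp_affine q0) U ->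
  exists2 e : R, 0 < e & forall q, qnorm2 (q - q0) < e -> U (hp_affine q).
Proof. by move=> /(@continuous_hp_affine R q0); exact: nbhs_qnorm2. Qed.

Lemma nbhs_hp_infty (U : set (HP1 R)) : nbhs (hp_infty R) U ->
  exists2 e : R, 0 < e &
    forall q, q != 0 -> (qnorm2 q)^-1 < e -> U (hp_affine q).
Proof.
rewrite -hp_coaffine0 => /(@continuous_hp_coaffine R 0)/nbhs_qnorm2[e e0 eU].
exists e => // q q0 qe; rewrite -hp_coaffineV//.
by apply: eU; rewrite subr0 qnorm2V.
Qed.

(** The quaternion r om + w j with w = [Num.sqrt (profile r)] (u.1 + i u.2),
    for u on the unit circle. *)
Definition handle_quat om (r : R) u : quat R :=
  (r * complex.Re om, r * complex.Im om,
   Num.sqrt (profile r) * u.1, Num.sqrt (profile r) * u.2).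

(** The height t of the cylinder is |z| on a handle attached to 0 and 1 / |z|
    on one attached to infinity; either way it tends to 0 at the pole and to 1
    at the cube root of -1. *)
Definition radius P (t : R) : R := if P == hp_infty R then t^-1 else t.

Definition handle_map P om (c : R * R * R) : HP1 R :=
  hp_affine (handle_quat om (radius P c.2) c.1).

Definition handle P om : set (HP1 R) :=
  handle_map P om @` cylinder R `|` [set P; hp_of_C om].

Lemma radius_bounds P t : 0 < t < 1 ->
  [/\ 0 < radius P t, radius P t != 1 & (1 < radius P t) = (P == hp_infty R)].
Proof.
move=> /andP[t0 t1]; rewrite /radius; case: ifP => _.
  by rewrite invr_gt0 t0 invr_eq1 lt_eqF// invf_gt1.
by rewrite t0 lt_eqF// ltNge ltW.
Qed.

Lemma radiusK P t : radius P (radius P t) = t.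
Proof. by rewrite /radius; case: (P == _); rewrite ?invrK. Qed.

Lemma cylinderP u (t : R) :
  cylinder R (u, t) <-> u.1 ^+ 2 + u.2 ^+ 2 = 1 /\ 0 < t < 1.
Proof. by rewrite /cylinder /circle /= in_itv. Qed.

Lemma cube_root_norm om : om ^+ 3 = -1 ->
  complex.Re om ^+ 2 + complex.Im om ^+ 2 = 1.
Proof.
case: om => [x y] om3 /=.
have [X Y] : recube x y = -1 /\ imcube x y = 0.
  by move: om3; rewrite cubeE => -[-> ->]; rewrite oppr0.
apply/eqP; rewrite -(@eqrXn2 _ 3)// ?addr_ge0 ?sqr_ge0//.
by rewrite -cube_norm X Y; apply/eqP; ring.
Qed.

Lemma cube_root_equator : cube_roots_m1 R `<=` equator R.
Proof.
move=> om om3; apply/eqP; rewrite -(@pexpr_eq1 _ _ 3)// -normrX.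
by rewrite [om ^+ 3]om3 normrN1.
Qed.

Lemma qw_handle_neq0 om r u : 0 < r -> r != 1 -> u.1 ^+ 2 + u.2 ^+ 2 = 1 ->
  qw (handle_quat om r u) != 0.
Proof.
move=> r0 r1 u1; rewrite /qw /handle_quat /=.
have p0 : Num.sqrt (profile r) != 0 by rewrite sqrtr_eq0 -ltNge profile_gt0.
apply/eqP => -[/eqP + /eqP].
rewrite !mulf_eq0 (negbTE p0) /= => /eqP u10 /eqP u20.
by move: u1; rewrite u10 u20 expr0n /= addr0 => /eqP; rewrite eq_sym oner_eq0.
Qed.

Lemma qnorm2_handle_quat om r u : om ^+ 3 = -1 -> 0 <= profile r ->
  u.1 ^+ 2 + u.2 ^+ 2 = 1 -> qnorm2 (handle_quat om r u) = r ^+ 2 + profile r.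
Proof.
move=> /cube_root_norm om1 p0 u1; case: om om1 => [x y] /= om1.
set p := Num.sqrt (profile r).
have pE : p ^+ 2 = profile r by rewrite sqr_sqrtr.
transitivity (r ^+ 2 * (x ^+ 2 + y ^+ 2) + p ^+ 2 * (u.1 ^+ 2 + u.2 ^+ 2)).
  by ring.
by rewrite om1 u1 pE !mulr1.
Qed.

Lemma qnorm2_handle_quatB om r u : om ^+ 3 = -1 -> 0 <= profile r ->
    u.1 ^+ 2 + u.2 ^+ 2 = 1 ->
  qnorm2 (handle_quat om r u - quat_of_C om) = (r - 1) ^+ 2 + profile r.
Proof.
move=> /cube_root_norm om1 p0 u1; case: om om1 => [x y] /= om1.
set p := Num.sqrt (profile r).
have pE : p ^+ 2 = profile r by rewrite sqr_sqrtr.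
transitivity ((r - 1) ^+ 2 * (x ^+ 2 + y ^+ 2)
  + p ^+ 2 * (u.1 ^+ 2 + u.2 ^+ 2)).
  by ring.
by rewrite om1 u1 pE !mulr1.
Qed.

(** Left inverse of [handle_map]: it reads u off the direction of w, and the
    height off |z|, as [radius P] is an involution. *)
Definition handle_coord P (x : HP1 R) : R * R * R :=
  let q := affine_coord x in
  (q.1.2 / Num.sqrt (q.1.2 ^+ 2 + q.2 ^+ 2),
   q.2 / Num.sqrt (q.1.2 ^+ 2 + q.2 ^+ 2),
   radius P (Num.sqrt (q.1.1.1 ^+ 2 + q.1.1.2 ^+ 2))).

Lemma handle_mapK P om c : om ^+ 3 = -1 -> cylinder R c ->
  handle_coord P (handle_map P om c) = c.
Proof.
case: c => -[u1 u2] t om3 /cylinderP[/= cu ct].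
have [r0 r1 _] := radius_bounds P ct.
rewrite /handle_coord /handle_map hp_affineK /=.
set r := radius P t in r0 r1 *; have p0 := profile_gt0 r0 r1.
have -> : (Num.sqrt (profile r) * u1) ^+ 2 + (Num.sqrt (profile r) * u2) ^+ 2
    = profile r.
  by rewrite !exprMn -mulrDr cu mulr1 sqr_sqrtr// ltW.
have -> : (r * complex.Re om) ^+ 2 + (r * complex.Im om) ^+ 2 = r ^+ 2.
  by rewrite !exprMn -mulrDr cube_root_norm// mulr1.
rewrite sqrtr_sqr gtr0_norm// radiusK !(mulrC (Num.sqrt _)) !mulfK//.
all: by rewrite gt_eqF// sqrtr_gt0.
Qed.

Lemma continuous_radius P t : 0 < t -> {for t, continuous (radius P)}.
Proof.
move=> t0; rewrite /radius; case: (P == _); last exact: cvg_id.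
by apply: inv_continuous; rewrite gt_eqF.
Qed.

Lemma continuous_handle_map P om c :
  cylinder R c -> {for c, continuous (handle_map P om)}.
Proof.
case: c => u t /cylinderP[_ /andP[t0 _]].
have cr : {for (u, t), continuous (fun c : R * R * R => radius P c.2)}.
  have csnd : {for (u, t), continuous (snd : R * R * R -> R)} by exact: cvg_snd.
  exact: (continuous_comp csnd (@continuous_radius P t t0)).
have cp : {for (u, t),
    continuous (fun c : R * R * R => profile (radius P c.2))}.
  exact: (continuous_comp cr (@continuous_profile R _)).
have ch : {for (u, t), continuous (fun c : R * R * R =>
    (radius P c.2 * complex.Re om, radius P c.2 * complex.Im om,
     Num.sqrt (profile (radius P c.2)) * c.1.1,
     Num.sqrt (profile (radius P c.2)) * c.1.2) : quat R)}.
  by continuity.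
exact: (continuous_comp ch (@continuous_hp_affine R _)).
Qed.

Lemma sqrt_norm2_gt0 (a b : R) :
  (a +i* b)%C != 0 -> 0 < Num.sqrt (a ^+ 2 + b ^+ 2).
Proof.
move=> ab0; rewrite sqrtr_gt0 lt_neqAle addr_ge0 ?sqr_ge0// andbT eq_sym.
rewrite paddr_eq0 ?sqr_ge0// !sqrf_eq0.
by apply: contra_neqN ab0 => /andP[/eqP -> /eqP ->].
Qed.

Lemma continuous_handle_coord P q : qz q != 0 -> qw q != 0 ->
  {for hp_affine q, continuous (handle_coord P)}.
Proof.
move=> /sqrt_norm2_gt0 z0 /sqrt_norm2_gt0 w0.
have cz : {for q, continuous (fun q : quat R =>
    Num.sqrt (q.1.1.1 ^+ 2 + q.1.1.2 ^+ 2))} by continuity.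
have cr : {for q, continuous (fun q : quat R =>
    radius P (Num.sqrt (q.1.1.1 ^+ 2 + q.1.1.2 ^+ 2)))}.
  exact: (continuous_comp cz (@continuous_radius P _ z0)).
have c : {for affine_coord (hp_affine q), continuous (fun q : quat R =>
    (q.1.2 / Num.sqrt (q.1.2 ^+ 2 + q.2 ^+ 2),
     q.2 / Num.sqrt (q.1.2 ^+ 2 + q.2 ^+ 2),
     radius P (Num.sqrt (q.1.1.1 ^+ 2 + q.1.1.2 ^+ 2))))}.
  rewrite hp_affineK; continuity.
  3: exact: cr.
  1-2: by rewrite gt_eqF.
exact: (continuous_comp (@continuous_affine_coord R q) c).
Qed.

Lemma Chat_affine q : Chat R (hp_affine q) <-> qw q = 0.
Proof.
split=> [/ChatP[/hp_affine_neq_infty//|[a [b /hp_affine_inj ->]]]//|].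
case: q => [[[a b] c] d] [/= -> ->]; apply/ChatP; right.
by exists a, b.
Qed.

Lemma handle_map_notin_Chat P om c :
  cylinder R c -> ~ Chat R (handle_map P om c).
Proof.
case: c => u t /cylinderP[cu ct] /Chat_affine/eqP.
by have [r0 r1 _] := radius_bounds P ct; apply/negP/qw_handle_neq0.
Qed.

Lemma poles_Chat P om : poles R P -> [set P; hp_of_C om] `<=` Chat R.
Proof.
move=> PP x [->|->]; last by left; exists om.
by case: PP => ->; [left; exists 0|right].
Qed.

Lemma handle_minus_ends P om : poles R P ->
  handle P om `\` [set P; hp_of_C om] = handle_map P om @` cylinder R.
Proof.
move=> PP; rewrite /handle setDUl setDv setU0; apply/setDidPl.
apply/seteqP; split=> // x [[c cc <-]] /(poles_Chat PP).
exact: handle_map_notin_Chat.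
Qed.

(** Convergence is uniform on the circle because the norm of [handle_quat om r
    u] does not depend on u. Near infinity a point is small in the other chart
    when its norm is large. *)
Lemma pole_end P om : poles R P -> om ^+ 3 = -1 -> forall U, nbhs P U ->
  \forall t \near 0^'+, forall c, cylinder R c -> c.2 = t ->
    U (handle_map P om c).
Proof.
move=> PP om3 U; rewrite /handle_map.
have small (e : R) : 0 < e -> \forall t \near 0^'+, t ^+ 2 + profile t < e.
  move=> e0; apply: cvg_within.
  have c : {for (0 : R), continuous (fun t : R => t ^+ 2 + profile t)}.
    by have cp := @continuous_profile R 0; continuity; exact: cp.
  have := c _ (open_nbhs_nbhs (conj (@open_lt _ e) _)); apply.
  by rewrite /= expr0n profile0 add0r.
case: PP => ->.
  have rE t : radius (hp_of_C 0) t = t.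
    by rewrite /radius; case: eqP => // /hp_affine_neq_infty.
  move=> /nbhs_hp_affine[e e0 eU]; near=> t => -[u t'] /cylinderP[cu ct] /= tE.
  have [r0 r1 _] := radius_bounds (hp_of_C 0) ct.
  have pr := profile_gt0 r0 r1.
  apply: eU; rewrite [quat_of_C 0](_ : _ = 0)// subr0.
  rewrite (qnorm2_handle_quat om3 (ltW pr) cu) rE tE.
  by near: t; exact: small.
have rE t : radius (hp_infty R) t = t^-1 by rewrite /radius eqxx.
move=> /nbhs_hp_infty[e e0 eU]; near=> t => -[u t'] /cylinderP[cu ct] /= tE.
have [r0 r1 _] := radius_bounds (hp_infty R) ct.
have w0 := qw_handle_neq0 om r0 r1 cu.
have [t0 t1] : 0 < t' /\ t' != 1 by case/andP: ct => ? ?; rewrite lt_eqF.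
have pt := profile_gt0 t0 t1; have pr := profile_gt0 r0 r1.
apply: eU; first by apply: contra_neq w0 => ->.
rewrite (qnorm2_handle_quat om3 (ltW pr) cu).
apply: (@le_lt_trans _ _ (t' ^+ 2)).
  rewrite -[leRHS]invrK lef_pV2 ?posrE ?invr_gt0 ?exprn_gt0//; last first.
    by rewrite addr_gt0 ?exprn_gt0.
  by rewrite -exprVn rE lerDl -rE ltW.
apply: (@lt_trans _ _ (t' ^+ 2 + profile t')); first by rewrite ltrDl.
by rewrite tE; near: t; exact: small.
Unshelve. all: by end_near.
Qed.

(** As r tends to 1, the squared distance (r - 1)^2 + [profile r] from the
    circle of radius parameter r to om tends to 0. *)
Lemma root_end P om : om ^+ 3 = -1 -> forall U, nbhs (hp_of_C om) U ->
  \forall t \near 1^'-, forall c, cylinder R c -> c.2 = t ->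
    U (handle_map P om c).
Proof.
move=> om3 U /nbhs_hp_affine[e e0 eU]; rewrite /handle_map.
near=> t => -[u t'] /cylinderP[cu ct] /= tE.
have [r0 r1 _] := radius_bounds P ct.
have pr := profile_gt0 r0 r1.
apply: eU; rewrite (qnorm2_handle_quatB om3 (ltW pr) cu) tE.
near: t; apply: cvg_within.
have cr := @continuous_radius P 1 ltr01.
have cp := continuous_comp cr (@continuous_profile R _).
have c : {for (1 : R), continuous (fun t : R =>
    (radius P t - 1) ^+ 2 + profile (radius P t))} by continuity.
apply: (c [set x | x < e]); apply: open_nbhs_nbhs; split; first exact: open_lt.
have -> : radius P 1 = 1 by rewrite /radius invr1 if_same.
by rewrite /= subrr expr0n profile1 add0r.
Unshelve. all: by end_near.
Qed.

Lemma pinched_handle_handle P om : poles R P -> om ^+ 3 = -1 ->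
  pinched_handle P (hp_of_C om) (handle P om).
Proof.
move=> PP om3; split; [by right; left|by right; right| |].
  rewrite /handle setIUl (setIidl (@poles_Chat P om PP)).
  rewrite (_ : _ `&` _ = set0) ?set0U//.
  apply/seteqP; split=> // x [[c cc <-]].
  exact: handle_map_notin_Chat.
have cf : {within cylinder R, continuous (handle_map P om)}.
  apply: continuous_in_subspaceT => c /set_mem cc.
  exact: continuous_handle_map.
have BE := handle_minus_ends om PP.
have cg : {within handle P om `\` [set P; hp_of_C om],
    continuous (handle_coord P)}.
  apply: continuous_in_subspaceT => x /set_mem; rewrite BE => -[c cc <-].
  case: c cc => u t /cylinderP[cu ct].
  have [r0 r1 _] := radius_bounds P ct.
  apply: continuous_handle_coord; last exact: qw_handle_neq0.
  apply/eqP => -[/eqP + /eqP]; rewrite !mulf_eq0 gt_eqF//= => /eqP x0 /eqP y0.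
  move: (cube_root_norm om3); rewrite x0 y0 expr0n addr0 => /eqP.
  by rewrite eq_sym oner_eq0.
have [||||h hh hE] := homeomorphism_set_type cf cg.
- by move=> c cc; rewrite BE; exists c.
- by move=> x; rewrite BE => -[c cc <-]; rewrite handle_mapK.
- by move=> c cc; rewrite handle_mapK.
- by move=> x; rewrite BE => -[c cc <-]; rewrite handle_mapK.
exists h; split=> // U nU.
- apply: filterS (pole_end PP om3 nU) => t tU c ct.
  by rewrite hE; apply: tU => //; exact/set_mem/(valP c).
- apply: filterS (root_end P om3 nU) => t tU c ct.
  by rewrite hE; apply: tU => //; exact/set_mem/(valP c).
Qed.

End Handles.

(** * Assembling the locus *)

Section Assembly.
Variable R : realType.
Local Notation C := R[i].

(** The discriminant of X^3 + 1 is -27. *)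
Lemma card_cube_roots : (cube_roots_m1 R #= `I_3)%card.
Proof.
have := card_roots_cubic (0 : C) 0 1 (oner_neq0 C).
have -> : discriminant3 1 0 0 1 = - 27%:R :> C by rewrite /discriminant3; ring.
rewrite oppr_eq0 pnatr_eq0 /= (_ : mkset _ = cube_roots_m1 R) => [->//|].
apply/seteqP; split=> z /=; rewrite mul1r !mul0r !addr0.
  by move=> /eqP; rewrite addr_eq0 => /eqP.
by move=> ->; rewrite addNr.
Qed.

Lemma card_poles : (poles R #= `I_2)%card.
Proof.
rewrite (_ : poles R = [set` [:: hp_of_C 0; hp_infty R]]).
  apply: (@card_set_uniq _ [:: hp_of_C 0; hp_infty R]).
  by rewrite /= inE andbT; apply/eqP/hp_affine_neq_infty.
apply/seteqP; split=> x /=; rewrite !inE.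
  by case=> ->; rewrite eqxx ?orbT.
by case/orP=> /eqP; [left|right].
Qed.

(** The norm of z gives the radius; the radius is less than 1 exactly on the
    handles attached to 0, and z divided by it is the cube root of -1. *)
Lemma handle_map_inj P z P' z' c c' : poles R P -> poles R P' ->
    z ^+ 3 = -1 -> z' ^+ 3 = -1 -> cylinder R c -> cylinder R c' ->
  handle_map P z c = handle_map P' z' c' -> (P, z) = (P', z').
Proof.
case: c c' => [u t] [u' t'] PP PP' z3 z3' /cylinderP[_ ct] /cylinderP[_ ct'].
have [r0 _ rP] := radius_bounds P ct; have [r0' _ rP'] := radius_bounds P' ct'.
move=> /hp_affine_inj; rewrite /handle_quat /= => -[eR eI _ _].
set r := radius P t in r0 rP eR eI; set r' := radius P' t' in r0' rP' eR eI.
have rr : r = r'.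
  apply/eqP; rewrite -(@eqrXn2 _ 2)// ?ltW//; apply/eqP.
  rewrite -[LHS]mulr1 -[RHS]mulr1 -{1}(cube_root_norm z3) -(cube_root_norm z3').
  by rewrite !mulrDr -!exprMn eR eI.
have PE : P = P'.
  move: rP' rP; rewrite -rr => -> {rr}.
  have zoo : (hp_of_C 0 == hp_infty R) = false.
    by apply/eqP/hp_affine_neq_infty.
  by case: PP => ->; case: PP' => ->; rewrite ?eqxx ?zoo.
congr (_, _) => //.
move: eR eI; rewrite -rr; case: (z) (z') => [x y] [x' y'] /=.
by move=> /(mulfI (lt0r_neq0 r0)) -> /(mulfI (lt0r_neq0 r0)) ->.
Qed.

Lemma handle_cap P z P' z' : poles R P -> z ^+ 3 = -1 ->
    poles R P' -> z' ^+ 3 = -1 -> (P, z) <> (P', z') ->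
  handle P z `&` handle P' z' `<=` [set P; hp_of_C z] `&` [set P'; hp_of_C z'].
Proof.
move=> PP z3 PP' z3' neq x [[[c cc <-]|xe] [[c' cc' xE]|xe']] //.
- by case: neq; apply: (handle_map_inj PP PP' z3 z3' cc cc').
- by case: (@handle_map_notin_Chat _ P z _ cc); exact: (poles_Chat PP' xe').
- case: (@handle_map_notin_Chat _ P' z' _ cc'); rewrite xE.
  exact: (poles_Chat PP xe).
Qed.

(** Outside the Riemann sphere, the radius r given by [Disc_affineP]
    determines the pole: 0 if r < 1 and infinity if r > 1. *)
Lemma Disc_scroll : Disc 3 (cubic_scroll R) =
  Chat R `|` \bigcup_(Pz in poles R `*` cube_roots_m1 R) handle Pz.1 Pz.2.
Proof.
have ChatD x : Chat R x -> Disc 3 (cubic_scroll R) x.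
  by case=> [[z _ <-]|->]; [exact: Disc_hp_of_C|exact: Disc_infty].
apply/seteqP; split; last first.
  move=> x [/ChatD//|[[P z] [/= PP z3] [[[u t] /cylinderP[cu ct] <-]|xe]]].
    have [r0 r1 _] := radius_bounds P ct.
    apply/Disc_affineP; first exact: qw_handle_neq0.
    exists (radius P t), z; split=> //=.
      by case: (z) => a b; congr Complex => /=; ring.
    rewrite !exprMn -mulrDr [X in _ * X]cu mulr1 sqr_sqrtr//.
    exact/ltW/profile_gt0.
  by apply: ChatD; exact: (poles_Chat PP xe).
elim/HP1_ind => [_|q Dq]; first by left; right.
have [w0|w0] := eqVneq (qw q) 0; first by left; apply/Chat_affine.
move/(Disc_affineP w0): Dq => [r [z [r0 r1 z3 qzE sE]]]; right.
have [P PP rP] : exists2 P, poles R P & 0 < radius P r < 1.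
  case: (ltgtP r 1) r1 => // r1 _.
    exists (hp_of_C 0); first by left.
    rewrite /radius; case: eqP => [/hp_affine_neq_infty//|_].
    by rewrite r0.
  exists (hp_infty R); first by right.
  by rewrite /radius eqxx invr_gt0 r0 invf_lt1.
exists (P, z) => //; left.
have p0 := profile_gt0 r0 r1.
have sp0 : Num.sqrt (profile r) != 0 by rewrite gt_eqF// sqrtr_gt0.
exists (q.1.2 / Num.sqrt (profile r), q.2 / Num.sqrt (profile r), radius P r).
  apply/cylinderP; split=> //=.
  by rewrite !expr_div_n -mulrDl sE sqr_sqrtr ?divff ?gt_eqF// ltW.
rewrite /handle_map /= radiusK /handle_quat /=; congr hp_affine.
case: q {w0 sE} qzE => [[[a b] c] d] /=; case: (z) => x y [-> ->].
by congr (_, _, _, _); rewrite ?(mulrC (Num.sqrt _)) ?divfK//=; ring.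
Qed.

End Assembly.

Theorem theorem1p6 (R : realType) :
  [/\ homeomorphic (sphere2 R) (Chat R),
      cube_roots_m1 R `<=` equator R,
      (poles R `*` cube_roots_m1 R #= `I_6)%card &
      exists Sigma : HP1 R * R[i] -> set (HP1 R),
        [/\ forall P z, poles R P -> cube_roots_m1 R z ->
              pinched_handle P (hp_of_C z) (Sigma (P, z)),
            forall P z P' z', poles R P -> cube_roots_m1 R z ->
              poles R P' -> cube_roots_m1 R z' -> (P, z) <> (P', z') ->
              Sigma (P, z) `&` Sigma (P', z') `<=`
                [set P; hp_of_C z] `&` [set P'; hp_of_C z'] &
            Disc 3 (cubic_scroll R) =
              Chat R `|` \bigcup_(Pz in poles R `*` cube_roots_m1 R) Sigma Pz]].
Proof.
split.
- exact: homeomorphic_sphere2_Chat.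
- exact: cube_root_equator.
- exact: card_setX (card_poles R) (card_cube_roots R).
exists (fun Pz => handle Pz.1 Pz.2); split.
- by move=> P z; exact: pinched_handle_handle.
- by move=> P z P' z' PP z3 PP' z3'; exact: handle_cap.
- exact: Disc_scroll.
Qed.
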